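(* For each even integer $c\ge 2$, let $\mathcal{P}_c$ be the Gauss–Legendre distribution with smallest output $p_0$; put $\eta_1=1/2$, $\eta_2=\sqrt{c}/2$, and let $\varepsilon_1=\varepsilon_1(c),\varepsilon_2=\varepsilon_2(c)\in(0,1)$ be such that $\log(1/\varepsilon_2)/\log(1/\varepsilon_1)$ stays bounded as $c\to\infty$. Set $\mathcal{R}=\min_{1\le\ell\le c}\mathcal{R}_{\ell,\mathcal{P}_c}$, $\psi_1=\psi_2=\sigma(p_0)$, let $x_i>0$ be defined by $x_ir(x_i)=\eta_i\mathcal{R}\psi_1/c$, $A_i=\frac{c}{(1-\eta_1-\eta_2/c)\mathcal{R}}\cdot\frac{\psi_2}{x_i}\log\frac{1}{\varepsilon_i}$ ($i=1,2$), and $m=A_1+A_2$. Then for all sufficiently large even $c$, $m<0.206021\cdot 100\,c^2\log(1/\varepsilon_1)$; that is, the code length $m$ is less than $20.6021\%$ of the Tardos code length $100c^2\log(1/\varepsilon_1)$.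
   Context: A finite bias distribution is a probability distribution supported on a finite subset of $(0,1)$ that is symmetric (outputs $a$ and $1-a$ with equal probability); $E_p$ is expectation over its output $p$. $\sigma(p)=\sqrt{(1-p)/p}$; $f_{\ell,x}(p)=p^x(1-p)^{\ell-x}(x\sigma(p)-(\ell-x)\sigma(1-p))$; $R_{\ell,x}=\max\{0,E_p[f_{\ell,x}(p)]\}$; $\mathcal{R}_{\ell,\mathcal{P}}=E_p[-f_{\ell,0}(p)]-\sum_{x=1}^{\ell-1}\binom{\ell}{x}R_{\ell,x}$. $r(t)=(e^t-1-t)/t^2$ for $t>0$. $\log$ is the natural logarithm. Gauss–Legendre distribution: for $c=2\nu$, let $\widetilde{L}_\nu(t)=\left.\left(\frac{d}{du}\right)^{\nu}(u^2-1)^{\nu}\right|_{u=2t-1}$; $\mathcal{P}_c$ takes as values the $\nu$ zeroes $p$ of $\widetilde L_\nu$, each with probability proportional to $\bigl((p(1-p))^{3/2}\widetilde L_\nu{}'(p)^2\bigr)^{-1}$. The Tardos code length for security parameter $\varepsilon_1=\varepsilon/N$ is $100c^2\lceil\log(N/\varepsilon)\rceil\ge 100c^2\log(1/\varepsilon_1)$. *)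

(* Defs.v *)
From HB Require Import structures.
From mathcomp Require Import all_boot all_order all_algebra.
From mathcomp Require Import all_classical all_reals all_analysis.
Set Implicit Arguments. Unset Strict Implicit. Unset Printing Implicit Defensive.
Import Order.TTheory GRing.Theory Num.Theory.
Local Open Scope classical_set_scope.
Local Open Scope ring_scope.

Section Defs.
Variable R : realType.

Definition sigma (p : R) : R := Num.sqrt ((1 - p) / p).

Definition fTardos (l x : nat) (p : R) : R :=
  p ^+ x * (1 - p) ^+ (l - x)%N
    * (x%:R * sigma p - (l - x)%N%:R * sigma (1 - p)).

(* A finite distribution given by a finite support S and (unnormalized)
   positive weights w: the probability of p in S is w p / sum_{q in S} w q. *)
Definition Exp (S : set R) (w : R -> R) (g : R -> R) : R :=
  (\sum_(p \in S) w p * g p) / (\sum_(p \in S) w p).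

Definition Rlx (S : set R) (w : R -> R) (l x : nat) : R :=
  Num.max 0 (Exp S w (fTardos l x)).

Definition calR (S : set R) (w : R -> R) (l : nat) : R :=
  Exp S w (fun p => - fTardos l 0 p)
  - \sum_(1 <= x < l) 'C(l, x)%:R * Rlx S w l x.

Definition rfun (t : R) : R := (expR t - 1 - t) / t ^+ 2.

Definition Ltil (nu : nat) : {poly R} :=
  ((('X ^+ 2 - 1) ^+ nu)^`(nu)) \Po (2%:R *: 'X - 1).

(* Gauss--Legendre distribution P_c, c = 2 nu: support = zeroes of Ltil nu,
   weight proportional to ((p(1-p))^(3/2) Ltil'(p)^2)^(-1). *)
Definition GLsupport (c : nat) : set R := [set p | root (Ltil c./2) p].
Definition GLweight (c : nat) (p : R) : R :=
  ((p * (1 - p)) `^ (3%:R / 2%:R) * ((Ltil c./2)^`()).[p] ^+ 2)^-1.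

Definition GLp0 (c : nat) : R := inf (GLsupport c).

Definition calRmin (c : nat) : R :=
  \big[Num.min/calR (GLsupport c) (GLweight c) 1]_(1 <= l < c.+1)
     calR (GLsupport c) (GLweight c) l.

End Defs.

(* Main.v *)
Require Import Defs.
From HB Require Import structures.
From mathcomp Require Import all_boot all_order all_algebra.
From mathcomp Require Import all_classical all_reals all_analysis.
From mathcomp Require Import ring lra zify.
From mathcomp Require Import polyrcf.
From Stdlib Require PeanoNat.
Import Order.TTheory GRing.Theory Num.Theory.
Import numFieldNormedType.Exports.
Local Open Scope classical_set_scope.
Local Open Scope ring_scope.

(** Write c = 2 nu.  Up to the factor sqrt (p (1 - p)), f_{l,x} is the derivative
    of p^x (1 - p)^(l - x), and the weights of P_c times that factor are the
    Gauss-Legendre weights on [0, 1].  Exactness of the quadrature in degree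
    < 2 nu therefore gives R_{l,x} = 0 for 0 < x < l, and R_l = 1 / Z for all
    l <= c, where Z is the quadrature of 1 / sqrt (p (1 - p)).  With u = 2p - 1,
    this function is twice (1 - u^2)^(-1/2), whose Taylor coefficients are
    nonnegative, so the quadrature underestimates its integral pi: Z <= pi.

    The smallest node is located from the expansion of the Legendre polynomial
    at 0: after rescaling by nu (nu + 1) its terms tend to those of
    sum_k (-z)^k / k!^2, and the alternating sum has no zero below z = 1.445.
    This bounds sigma (p_0) / c by about 1 / 2.404, which with Z <= pi yields
    the constant for A_1, while x_2 grows like log c and makes A_2
    negligible. *)

Set Implicit Arguments. Unset Strict Implicit. Unset Printing Implicit Defensive.

(** * Integration of polynomials and Legendre polynomials on [0, 1] *)

Section PolyIntegral.
Variable R : numFieldType.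
Implicit Types p q g : {poly R}.

(** The integral over [0, 1], written on coefficients so that it stays within algebra over any
    [numFieldType]. *)
Definition pint p : R := \sum_(i < size p) p`_i / i.+1%:R.

Lemma pint_widen n p : (size p <= n)%N ->
  pint p = \sum_(i < n) p`_i / i.+1%:R.
Proof.
move=> le_pn; rewrite /pint (big_ord_widen _ (fun i => p`_i / i.+1%:R) le_pn).
rewrite big_mkcond; apply: eq_bigr => i _; case: ltnP => // le_pi.
by rewrite nth_default // mul0r.
Qed.

Fact pint_is_linear : scalar pint.
Proof.
move=> a p q /=; set n := maxn (size p) (size q).
have sp : (size p <= n)%N by rewrite leq_maxl.
have sq : (size q <= n)%N by rewrite leq_maxr.
have spq : (size (a *: p + q : {poly R})%R <= n)%N.
  rewrite (leq_trans (size_polyD _ _)) // geq_max sq andbT.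
  exact: leq_trans (size_scale_leq _ _) sp.
rewrite (pint_widen spq) (pint_widen sp) (pint_widen sq) mulr_sumr -big_split.
by apply: eq_bigr => i _; rewrite coefD coefZ mulrDl mulrA.
Qed.

HB.instance Definition _ :=
  GRing.isLinear.Build R {poly R} R _ pint pint_is_linear.

Lemma pint_deriv p : pint p^`() = p.[1] - p.[0].
Proof.
rewrite (@pint_widen (size p).-1); last by rewrite size_poly.
rewrite horner_coef0 (@horner_coef_wide _ (size p).-1.+1); last by case: (size p).
rewrite big_ord_recl expr1n mulr1 addrAC subrr add0r; apply: eq_bigr => i _.
by rewrite coef_deriv expr1n mulr1 -(mulr_natr p`_i.+1) mulfK // pnatr_eq0.
Qed.

Lemma pint_by_parts p q :
  pint (p^`() * q) = p.[1] * q.[1] - p.[0] * q.[0] - pint (p * q^`()).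
Proof. by rewrite -!hornerM -pint_deriv derivM raddfD addrK. Qed.

Lemma derivn_XsubC_exp (a : R) n j q : (j <= n)%N ->
  exists r, (('X - a%:P) ^+ n * q)^`(j) = ('X - a%:P) ^+ (n - j) * r.
Proof.
elim: j => [|j IHj] lejn; first by exists q; rewrite derivn0 subn0.
have [r Er] := IHj (ltnW lejn).
rewrite derivnS Er -[(n - j)%N]prednK ?subn_gt0 // -subnS.
exists (r *+ (n - j.+1).+1 + ('X - a%:P) * r^`()).
rewrite derivM deriv_exp derivXsubC mul1r /= exprS.
rewrite -(mulr_natr r) -(mulr_natr (_ ^+ _)).
move: ('X - _) (_ ^+ _) _%:R r^`() => y z t r'; ring.
Qed.

Lemma derivn_XsubC_exp_root (a : R) n j q : (j < n)%N ->
  (('X - a%:P) ^+ n * q)^`(j).[a] = 0.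
Proof.
move=> ltjn; have [r ->] := derivn_XsubC_exp a q (ltnW ltjn).
by rewrite hornerM horner_exp hornerXsubC subrr expr0n subn_eq0 leqNgt ltjn mul0r.
Qed.

End PolyIntegral.

(** * Shifted Legendre polynomials and their zeroes *)

Section Legendre.
Variable R : rcfType.
Implicit Types p q g : {poly R}.

Definition rodrigues n : {poly R} := ('X ^+ 2 - 'X) ^+ n.
(** By the Rodrigues formula this is n! times the Legendre polynomial shifted to [0, 1]. *)
Definition legendre n : {poly R} := (rodrigues n)^`(n).

Lemma rodriguesE n : rodrigues n = 'X ^+ n * ('X - 1) ^+ n.
Proof. by rewrite /rodrigues -exprMn; congr (_ ^+ _); ring. Qed.

Lemma derivn_rodrigues0 n j : (j < n)%N -> (rodrigues n)^`(j).[0] = 0.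
Proof.
move=> ltjn; have := derivn_XsubC_exp_root (0 : R) (('X - 1) ^+ n) ltjn.
by rewrite polyC0 subr0 -rodriguesE.
Qed.

Lemma derivn_rodrigues1 n j : (j < n)%N -> (rodrigues n)^`(j).[1] = 0.
Proof.
move=> ltjn; have := derivn_XsubC_exp_root (1 : R) ('X ^+ n) ltjn.
by rewrite polyC1 mulrC -rodriguesE.
Qed.

Lemma coef_legendre n k :
  (legendre n)`_k = (-1) ^+ (n - k) *+ 'C(n, k) *+ (n + k) ^_ n.
Proof.
rewrite /legendre coef_derivn rodriguesE coefXnM ltnNge leq_addr /= addKn.
congr (_ *+ _); rewrite addrC exprDn coef_sum.
transitivity (\sum_(i < n.+1 | i == k :> nat) ((-1) ^+ (n - i) *+ 'C(n, i) : R)).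
  rewrite [RHS]big_mkcond; apply: eq_bigr => i _.
  rewrite coefMn -[-1]/(-(1%:P)) -polyCN -polyC_exp coefCM coefXn eq_sym.
  by case: eqP => _; rewrite ?mulr1 // mulr0 mul0rn.
have [ltkn|ltnk] := ltnP k n.+1.
  by rewrite (big_pred1 (Ordinal ltkn)).
by rewrite bin_small // mulr0n big1 // => i /eqP ik; rewrite -ik ltnNge -ltnS ltn_ord in ltnk.
Qed.

Lemma size_legendre n : size (legendre n) = n.+1.
Proof.
apply/eqP; rewrite eqn_leq; apply/andP; split.
  by apply/leq_sizeP => k ltnk; rewrite coef_legendre bin_small // mulr0n mul0rn.
rewrite ltnNge; apply/negP => /leq_sizeP /(_ n (leqnn _)) /eqP.
rewrite coef_legendre binn subnn expr0 mulr1n pnatr_eq0 -leqn0 leqNgt ffact_gt0.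
by rewrite leq_addr.
Qed.

Lemma legendre0 n : (legendre n).[0] = (-1) ^+ n *+ n`!.
Proof. by rewrite horner_coef0 coef_legendre subn0 bin0 addn0 ffactnn. Qed.

Lemma legendre_reflect n : legendre n \Po (1 - 'X) = (-1) ^+ n *: legendre n.
Proof.
have derivn_comp p j : (p \Po (1 - 'X))^`(j) = (-1) ^+ j *: (p^`(j) \Po (1 - 'X)).
  elim: j => [|j IHj]; first by rewrite expr0 scale1r.
  rewrite derivnS IHj derivZ deriv_comp.
  have -> : (1 - 'X : {poly R})^`() = -1.
    by rewrite derivB derivX -polyC1 derivC sub0r.
  by rewrite mulrN1 derivnS exprS -scalerA scaleN1r scalerN.
have := derivn_comp (rodrigues n) n.
have -> : rodrigues n \Po (1 - 'X) = rodrigues n.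
  rewrite /rodrigues rmorphXn /= rmorphB rmorphXn /= comp_polyX.
  by congr (_ ^+ _); ring.
by rewrite -/(legendre n) => {2}->; rewrite scalerA -expr2 sqrr_sign scale1r.
Qed.

Lemma legendre1_sqr n : (legendre n).[1] ^+ 2 = (legendre n).[0] ^+ 2.
Proof.
have /(congr1 (horner^~ 1)) := legendre_reflect n.
rewrite horner_comp hornerZ !hornerE subrr => ->.
by rewrite exprMn sqrr_sign mul1r.
Qed.

(** Integrate by parts n times: derivatives of [rodrigues n] of order below n vanish at 0 and 1, and
    the n-th derivative of [g] is zero. *)
Lemma legendre_orthogonal n g : (size g <= n)%N -> pint (legendre n * g) = 0.
Proof.
move=> sgn.
have step j : (j <= n)%N ->
    pint (legendre n * g) = (-1) ^+ j * pint ((rodrigues n)^`(n - j) * g^`(j)).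
  elim: j => [|j IHj] lejn; first by rewrite mul1r subn0.
  rewrite IHj 1?ltnW // -[(n - j)%N]prednK ?subn_gt0 // -subnS derivnS.
  rewrite pint_by_parts derivn_rodrigues1 ?derivn_rodrigues0 ?ltn_subrL ?(leq_ltn_trans _ lejn) //.
  by rewrite !mul0r subrr sub0r -derivnS mulrN exprS mulN1r mulNr.
by rewrite (step n) // subnn (derivn_poly0 sgn) mulr0 raddf0 mulr0.
Qed.

Lemma poly_rolle_path (p : {poly R}) x s : path <%R x s -> all (root p) (x :: s) ->
  exists t, [/\ path <%R x t, size t = size s, all (root p^`()) t &
                all (< last x s) t].
Proof.
elim: s x => [|y s IHs] x /=; first by exists [::].
move=> /andP[ltxy pys] /and3P[px py ps].
have [||t [pyt szt rt lt]] := IHs y; rewrite /= ?py //.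
have [|c] := @poly_rolle _ x y p ltxy; first by rewrite (rootP px) (rootP py).
rewrite in_itv /= => /andP[ltxc ltcy] p'c.
exists (c :: t); split=> /=.
- rewrite ltxc /=; case: t pyt {szt rt lt} => //= z t /andP[ltyz ->].
  by rewrite (lt_trans ltcy).
- by rewrite szt.
- by rewrite rt andbT; apply/rootP.
- rewrite lt andbT (lt_le_trans ltcy) //.
  have := pys; rewrite lt_path_sortedE => /andP[/allP ys _].
  by have := mem_last y s; rewrite inE => /predU1P[->|/ys/ltW].
Qed.

(** Repeated Rolle: while j < n the j-th derivative of [rodrigues n] vanishes at both endpoints
    besides j interior points, so the next derivative gains one interior zero. *)
Lemma legendre_roots n : exists s : seq R,
  [/\ uniq s, size s = n, all (fun x => 0 < x < 1) s & all (root (legendre n)) s].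
Proof.
suff [s [ps szs rs lts]] : exists s : seq R, [/\ path <%R 0 s, size s = n,
    all (root (legendre n)) s & all (< 1) s].
  exists s; split=> //.
    exact/lt_sorted_uniq/(path_sorted ps).
  move: ps; rewrite lt_path_sortedE => /andP[gts _].
  apply/allP => x xs; apply/andP; split; first exact: (allP gts).
  exact: (allP lts).
suff H j : (j <= n)%N -> exists s : seq R, [/\ path <%R 0 s, size s = j,
    all (root (rodrigues n)^`(j)) s & all (< 1) s] by exact: H.
elim: j => [|j IHj] ltjn.
  by exists [::].
have [s [ps szs rs lts]] := IHj (ltnW ltjn).
have [||t [pt szt rt ltt]] := @poly_rolle_path (rodrigues n)^`(j) 0 (rcons s 1).
- rewrite rcons_path ps /=; have := mem_last 0 s.
  by rewrite inE => /predU1P[->|/(allP lts)] //; rewrite ltr01.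
- rewrite /= all_rcons rs andbT; apply/andP; split; apply/rootP.
    exact: derivn_rodrigues0.
  exact: derivn_rodrigues1.
exists t; split=> //; first by rewrite szt size_rcons szs.
by move: ltt; rewrite last_rcons.
Qed.

End Legendre.

(** * Gauss--Legendre quadrature *)

Section GaussQuadrature.
Variables (R : rcfType) (n : nat) (s : seq R).
Hypotheses (uniq_s : uniq s) (size_s : size s = n).
Hypothesis s_itv : forall x, x \in s -> 0 < x < 1.
Hypothesis s_root : all (root (legendre R n)) s.

Implicit Types g : {poly R}.

Let L := legendre R n.
(** The Lagrange basis polynomial at the node [x], up to the factor L'(x). *)
Let cofac x := L %/ ('X - x%:P).

Lemma legendre_cofacE x : x \in s -> L = cofac x * ('X - x%:P).
Proof. by move=> xs; rewrite divpK // dvdp_XsubCl (allP s_root). Qed.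

Lemma size_cofac x : size (cofac x) = n.
Proof. by rewrite size_divp ?polyXsubC_eq0 // size_XsubC size_legendre subn1. Qed.

Lemma deriv_legendre_cofac x : x \in s -> L^`().[x] = (cofac x).[x].
Proof.
move=> xs; rewrite (legendre_cofacE xs) derivM derivXsubC !hornerE.
by rewrite subrr mulr0 add0r.
Qed.

Lemma cofac_eq0 x y : x \in s -> y \in s -> y != x -> (cofac x).[y] = 0.
Proof.
move=> xs ys neq_yx; apply/eqP.
have /rootP/eqP := allP s_root _ ys.
by rewrite -/L (legendre_cofacE xs) hornerM mulf_eq0 hornerXsubC subr_eq0 (negPf neq_yx) orbF.
Qed.

(** Nodes are simple zeroes: otherwise this polynomial of degree n - 1 would vanish at all n
    nodes. *)
Lemma cofac_neq0 x : x \in s -> (cofac x).[x] != 0.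
Proof.
move=> xs; apply/eqP => cx0.
have := @roots_geq_poly_eq0 _ (cofac x) s _ uniq_s _.
rewrite size_cofac size_s leqnn => /(_ _ isT) c0.
suff /c0 c00 : all (root (cofac x)) s.
  have := size_cofac x; rewrite c00 size_poly0 => n0.
  by move: size_s xs; rewrite -n0 => /size0nil ->.
apply/allP => y ys; apply/rootP.
by have [->|neq_yx] := eqVneq y x; last exact: cofac_eq0.
Qed.

Lemma sum_cofac (c : R -> R) y : y \in s ->
  \sum_(x <- s) c x * (cofac x).[y] = c y * (cofac y).[y].
Proof.
move=> ys; rewrite (bigD1_seq y) //= big_seq_cond big1 ?addr0 // => x /andP[xs neq].
by rewrite cofac_eq0 ?mulr0 // eq_sym.
Qed.

Lemma lagrange_cofac g : (size g <= n)%N ->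
  g = \sum_(x <- s) (g.[x] / L^`().[x]) *: cofac x.
Proof.
move=> sg; apply/eqP; rewrite -subr_eq0; apply/eqP.
apply: (@roots_geq_poly_eq0 _ _ s) => //; last first.
  rewrite size_s (leq_trans (size_polyD _ _)) // size_polyN geq_max sg /=.
  rewrite (leq_trans (size_sum _ _ _)) //; apply/bigmax_leqP_seq => x xs _.
  by rewrite (leq_trans (size_scale_leq _ _)) // size_cofac.
apply/allP => y ys; apply/rootP.
rewrite hornerD hornerN horner_sum.
under eq_bigr do rewrite hornerZ.
by rewrite sum_cofac // deriv_legendre_cofac // divfK ?cofac_neq0 // subrr.
Qed.

(** Divide [g] by [L]: the quotient is killed by orthogonality, and the remainder is interpolated at
    the nodes, where it equals [g]. *)
Lemma gauss_quadrature_cofac g : (size g <= n.*2)%N ->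
  pint g = \sum_(x <- s) g.[x] / L^`().[x] * pint (cofac x).
Proof.
move=> sg; have L0 : L != 0 by rewrite -size_poly_gt0 size_legendre.
rewrite {1}(divp_eq g L) raddfD /= mulrC legendre_orthogonal; last first.
  by rewrite size_divp // size_legendre leq_subLR addnn.
have sr : (size (g %% L)%R <= n)%N by rewrite -ltnS -(size_legendre R n) ltn_modp.
rewrite add0r (lagrange_cofac sr) linear_sum /= !big_seq.
apply: eq_bigr => x xs; rewrite linearZ /=; congr (_ / _ * _).
rewrite {2}(divp_eq g L) hornerD hornerM (rootP (allP s_root _ xs)).
by rewrite mulr0 add0r.
Qed.

(** The classical Gauss weight on [0, 1] without the factor [L.[0] ^+ 2], which all nodes share. *)
Definition gauss_weight x : R := (x * (1 - x) * L^`().[x] ^+ 2)^-1.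

Lemma gauss_weight_gt0 x : x \in s -> 0 < gauss_weight x.
Proof.
move=> xs; have /andP[x0 x1] := s_itv xs.
rewrite invr_gt0 mulr_gt0 //; first by rewrite mulr_gt0 ?subr_gt0.
by rewrite exprn_even_gt0 //= deriv_legendre_cofac // cofac_neq0.
Qed.

(* Exactness on L' * L / (X - x), which is integrated by parts, evaluates the
   weight of the node x. *)
Lemma pint_cofac x : x \in s ->
  pint (cofac x) / L^`().[x] = L.[0] ^+ 2 * gauss_weight x.
Proof.
move=> xs; have /andP[x0 x1] := s_itv xs.
have d0 : L^`().[x] != 0 by rewrite deriv_legendre_cofac ?cofac_neq0.
have szg : (size (L^`() * cofac x)%R <= n.*2)%N.
  rewrite (leq_trans (size_polyMleq _ _)) // size_cofac.
  have := lt_size_deriv (_ : L != 0); rewrite size_legendre.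
  by rewrite -size_poly_gt0 size_legendre => /(_ isT); lia.
have := gauss_quadrature_cofac szg.
have -> : \sum_(y <- s) (L^`() * cofac x).[y] / L^`().[y] * pint (cofac y)
   = L^`().[x] * pint (cofac x).
  rewrite (bigD1_seq x) //= big_seq_cond big1 => [|y /andP[ys neq]]; last first.
    by rewrite hornerM cofac_eq0 // mulr0 !mul0r.
  by rewrite addr0 hornerM -deriv_legendre_cofac // mulfK.
rewrite pint_by_parts legendre_orthogonal ?subr0; last first.
  by apply: leq_trans (size_poly _ _) _; rewrite size_cofac leq_pred.
have e1 : (cofac x).[1] = L.[1] / (1 - x).
  by rewrite [in RHS](legendre_cofacE xs) hornerM hornerXsubC mulfK // subr_eq0 gt_eqF.
have e0 : (cofac x).[0] = - L.[0] / x.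
  rewrite [in RHS](legendre_cofacE xs) hornerM hornerXsubC sub0r mulrN opprK mulfK //.
  by rewrite gt_eqF.
rewrite e1 e0 => E.
have -> : pint (cofac x) / L^`().[x] = L^`().[x] * pint (cofac x) / L^`().[x] ^+ 2.
  by field.
(* The boundary terms are L(1)^2 / (1 - x) and L(0)^2 / x; as L(1)^2 = L(0)^2, they add up to L(0)^2
   / (x (1 - x)). *)
rewrite -E /gauss_weight mulrA -expr2 legendre1_sqr -/L.
have xn0 : x != 0 by rewrite gt_eqF.
have x'n0 : 1 - x != 0 by rewrite subr_eq0 gt_eqF.
by field; rewrite d0 xn0 x'n0.
Qed.

Lemma gauss_quadrature g : (size g <= n.*2)%N ->
  pint g = L.[0] ^+ 2 * \sum_(x <- s) gauss_weight x * g.[x].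
Proof.
move=> /gauss_quadrature_cofac ->; rewrite mulr_sumr !big_seq.
apply: eq_bigr => x xs; rewrite mulrA -pint_cofac //; ring.
Qed.

(** By reflection L^2 is, up to sign, L(X) L(1 - X). Pairing X - x with 1 - X - x gives -1/4 of each
    factor shown, so L^2 is a polynomial in (2X - 1)^2. *)
Lemma legendre_sqr_roots :
  exists2 a : R, 0 <= a &
    L ^+ 2 = a *: \prod_(x <- s) (('X *+ 2 - 1) ^+ 2 - ((x *+ 2 - 1) ^+ 2)%:P).
Proof.
exists (lead_coef L ^+ 2 / 4 ^+ n); first by rewrite divr_ge0 ?sqr_ge0 ?exprn_ge0 // ler0n.
have EL : L = lead_coef L *: \prod_(x <- s) ('X - x%:P).
  rewrite -[s in RHS]map_id big_map; apply: all_roots_prod_XsubC => //.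
    by rewrite size_legendre size_s.
  by rewrite uniq_rootsE.
have EL' : (-1) ^+ n *: L = lead_coef L *: \prod_(x <- s) (1 - 'X - x%:P).
  rewrite -legendre_reflect -/L [in LHS]EL comp_polyZ rmorph_prod /=.
  by congr (_ *: _); apply: eq_bigr => x _; rewrite rmorphB /= comp_polyX comp_polyC.
have -> : L ^+ 2 = (-1) ^+ n *: (L * ((-1) ^+ n *: L)).
  by rewrite -scalerAr scalerA -expr2 sqrr_sign scale1r.
rewrite EL' [in LHS]EL -scalerAl -scalerAr !scalerA -big_split /=.
have -> : \prod_(x <- s) (('X *+ 2 - 1) ^+ 2 - ((x *+ 2 - 1) ^+ 2)%:P : {poly R}) =
   \prod_(x <- s) ((- 4)%:P * (('X - x%:P) * (1 - 'X - x%:P))).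
  have e4 : (- 4 : R)%:P = - 4%:R by rewrite polyCN polyC_natr.
  apply: eq_bigr => x _; rewrite e4 rmorphXn rmorphB rmorphMn rmorph1 /=; ring.
rewrite [in RHS]big_split /= big_const_seq count_predT size_s iter_mulr_1 -polyC_exp mul_polyC.
rewrite scalerA; congr (_ *: _).
have : (4 : R) ^+ n != 0 by rewrite expf_neq0 // pnatr_eq0.
rewrite [(-4) ^+ n]exprNn -EL.
by move: ((-1) ^+ n : R) (4 ^+ n : R) => u v v0; field.
Qed.

End GaussQuadrature.

(** * Positivity of the integral; division preserving nonnegative coefficients *)

Section PintNonneg.
Variable R : rcfType.

(** Quadrature with [size g] nodes is exact on [g] and has positive weights. *)
Lemma pint_ge0 (g : {poly R}) : (forall x, 0 <= g.[x]) -> 0 <= pint g.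
Proof.
move=> g_ge0; have [s [us szs s01 rs]] := legendre_roots R (size g).
have s_itv x : x \in s -> 0 < x < 1 by move/(allP s01).
rewrite (gauss_quadrature us szs s_itv rs); last by rewrite -addnn leq_addr.
rewrite mulr_ge0 ?sqr_ge0 // big_seq sumr_ge0 // => x xs.
by rewrite mulr_ge0 // ltW // (gauss_weight_gt0 us szs s_itv rs).
Qed.

(** Horner's scheme divides by X - y using only additions and multiplications by y >= 0, so
    nonnegative coefficients pass to the quotient; repeat over [ys]. *)
Lemma nneg_coef_division (A : {poly R}) (ys : seq R) :
    (forall i, 0 <= A`_i) -> (forall y, y \in ys -> 0 <= y) ->
  exists B r, [/\ A = B * \prod_(y <- ys) ('X - y%:P) + r,
    forall i, 0 <= B`_i & (size r <= size ys)%N].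
Proof.
elim: ys A => [|y ys IH] A A0 ys0.
  by exists A, 0; rewrite big_nil mulr1 addr0 size_poly0.
have [B1 [c [EA B10]]] : exists B1 c, A = B1 * ('X - y%:P) + c%:P /\ forall i, 0 <= B1`_i.
  have y0 : 0 <= y by rewrite ys0 ?mem_head.
  elim/poly_ind: A A0 {ys0} => [|A c IHA] A0.
    by exists 0, 0; rewrite mul0r addr0; split=> // i; rewrite coef0.
  have [|B1 [d [EA B10]]] := IHA.
    by move=> i; have := A0 i.+1; rewrite coefD coefMX coefC /= addr0.
  have Ay0 : 0 <= A.[y].
    rewrite horner_coef sumr_ge0 // => i _; rewrite mulr_ge0 ?exprn_ge0 //.
    by have := A0 i.+1; rewrite coefD coefMX coefC /= addr0.
  have Ed : A.[y] = d by rewrite EA !hornerE subrr mulr0 add0r.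
  exists (B1 * 'X + d%:P), (c + d * y); split.
    by rewrite EA rmorphD rmorphM /=; ring.
  move=> i; rewrite coefD coefMX coefC; case: i => [|i] /=; first by rewrite add0r -Ed.
  by rewrite addr0.
have [|B [r [EB B0 szr]]] := IH B1 B10.
  by move=> z zs; rewrite ys0 // inE zs orbT.
exists B, (r * ('X - y%:P) + c%:P); split=> //.
  by rewrite EA EB big_cons; ring.
rewrite /= (leq_trans (size_polyD _ _)) // geq_max.
rewrite (leq_trans (size_polyMleq _ _)) ?size_XsubC ?addn2 //=.
by rewrite (leq_trans (size_polyC_leq1 _)).
Qed.

Lemma horner_nneg_coef (A : {poly R}) x :
  (forall i, 0 <= A`_i) -> 0 <= x -> 0 <= A.[x].
Proof.
by move=> A0 x0; rewrite horner_coef sumr_ge0 // => i _; rewrite mulr_ge0 ?exprn_ge0.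
Qed.

End PintNonneg.

(** * The quadrature as a lower bound for the integral *)

Section GaussUpper.
Variables (R : rcfType) (n : nat) (s : seq R).
Hypotheses (uniq_s : uniq s) (size_s : size s = n).
Hypothesis s_itv : forall x, x \in s -> 0 < x < 1.
Hypothesis s_root : all (root (legendre R n)) s.
Hypothesis n_gt0 : (0 < n)%N.

(* The remainder of A modulo prod (v - (2x-1)^2), evaluated at v = (2p-1)^2, is
   integrated exactly; the quotient has nonnegative coefficients and multiplies
   a square. *)
Lemma gauss_le_pint (A : {poly R}) : (forall i, 0 <= A`_i) ->
  (legendre R n).[0] ^+ 2 * \sum_(x <- s) gauss_weight n x * A.[(x *+ 2 - 1) ^+ 2]
   <= pint (A \Po (('X *+ 2 - 1) ^+ 2)).
Proof.
move=> A0; set v : {poly R} := ('X *+ 2 - 1) ^+ 2.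
pose ys := [seq (x *+ 2 - 1) ^+ 2 | x <- s].
have [|B [r [EA B0 szr]]] := @nneg_coef_division _ A ys A0.
  by move=> y /mapP[x _ ->]; rewrite sqr_ge0.
have [a a0 EL] := legendre_sqr_roots uniq_s size_s s_root.
set L := legendre R n in EL *.
set M := \prod_(y <- ys) ('X - y%:P) in EA.
have EM : M \Po v = \prod_(x <- s) (v - ((x *+ 2 - 1) ^+ 2)%:P).
  rewrite /M /ys big_map rmorph_prod /=.
  by apply: eq_bigr => x _; rewrite rmorphB /= comp_polyX comp_polyC.
have a_neq0 : a != 0.
  apply/eqP => az; move: EL; rewrite az scale0r => /eqP.
  by rewrite expf_eq0 /= -size_poly_eq0 size_legendre.
have {}EM : M \Po v = a^-1 *: L ^+ 2 by rewrite EM EL scalerK.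
have size_v : (size v <= 3)%N.
  have sz2 : (size ('X *+ 2 - 1 : {poly R})%R <= 2)%N.
    by apply/leq_sizeP => -[|[|k]] // _; rewrite coefB coefMn coefX coef1 mul0rn subrr.
  by rewrite (leq_trans (size_poly_exp_leq _ _)) // -subn1; lia.
have szrv : (size (r \Po v) <= n.*2)%N.
  rewrite (leq_trans (size_comp_poly_leq _ _)) //.
  move: szr size_v n_gt0; rewrite size_map size_s.
  by move: (size r) (size v) => sr sv; case: sr sv => [|sr] [|[|[|sv]]] //=; lia.
have -> : pint (A \Po v) = a^-1 * pint (L ^+ 2 * (B \Po v)) + pint (r \Po v).
  by rewrite EA rmorphD rmorphM /= EM -scalerAr mulrC linearD /= linearZ.
rewrite (gauss_quadrature uniq_s size_s s_itv s_root szrv).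
have -> : \sum_(x <- s) gauss_weight n x * (r \Po v).[x] =
    \sum_(x <- s) gauss_weight n x * A.[(x *+ 2 - 1) ^+ 2].
  rewrite !big_seq; apply: eq_bigr => x xs; congr (_ * _).
  have vx : v.[x] = (x *+ 2 - 1) ^+ 2 by rewrite !hornerE.
  rewrite horner_comp vx EA hornerD hornerM.
  rewrite [M.[_]](_ : _ = 0) ?mulr0 ?add0r //; apply/rootP.
  by rewrite root_prod_XsubC; apply/mapP; exists x.
rewrite lerDr mulr_ge0 ?invr_ge0 // pint_ge0 // => x.
rewrite hornerM horner_exp mulr_ge0 ?sqr_ge0 // horner_comp horner_nneg_coef //.
by rewrite !hornerE sqr_ge0.
Qed.

End GaussUpper.

(** * The series of (1 - v)^(-1/2) *)

Section InverseSqrtSeries.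
Variable R : rcfType.

(* The Taylor coefficient 'C(2k, k) / 4^k of (1 - v)^(-1/2) at v^k. *)
Definition isqrt_coef k : R := \prod_(i < k) ((i.*2.+1)%:R / (i.*2.+2)%:R).
Local Notation a := isqrt_coef.

Lemma isqrt_coef0 : a 0 = 1.
Proof. by rewrite /isqrt_coef big_ord0. Qed.

Lemma isqrt_coefS k : a k.+1 = a k * ((2 * k%:R + 1) / (2 * k%:R + 2)).
Proof.
rewrite /isqrt_coef big_ord_recr /=; congr (_ * (_ / _)); rewrite -mul2n.
  by rewrite -addn1 natrD natrM.
by rewrite -addn2 natrD natrM.
Qed.

Lemma isqrt_coef_gt0 k : 0 < a k.
Proof. by rewrite prodr_gt0 // => i _; rewrite divr_gt0 ?ltr0n. Qed.

(** Coefficient form of ((1 - v)^(-1/2))^2 = 1 / (1 - v). For the first moment [M], the symmetry of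
    i and m - i gives 2 M(m) = m T(m), and the recurrence for [a] gives 2 M(m+1) = 2 M(m) + T(m);
    hence T is constant. *)
Lemma isqrt_coef_convolution n : \sum_(i < n.+1) a i * a (n - i)%N = 1.
Proof.
pose T m : R := \sum_(i < m.+1) a i * a (m - i)%N.
pose M m : R := \sum_(i < m.+1) i%:R * (a i * a (m - i)%N).
have TM m : 2 * M m = m%:R * T m.
  rewrite mulr_natl mulr2n {2}/M (reindex_inj rev_ord_inj) /= -big_split mulr_sumr.
  apply: eq_bigr => i _ /=; rewrite subSS subKn -1?ltnS //.
  by rewrite [a (m - i)%N * _]mulrC -mulrDl -natrD subnKC // -ltnS.
have MS m : 2 * M m.+1 = 2 * M m + T m.
  rewrite {1}/M big_ord_recl mul0r add0r !mulr_sumr -big_split /=.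
  apply: eq_bigr => i _; rewrite /bump /= add1n subSS isqrt_coefS -[i.+1%:R]natr1.
  have i0 : (2 * i%:R + 2 : R) != 0 by rewrite gt_eqF // ltr_wpDl ?mulr_ge0 ?ler0n ?ltr0n.
  by field.
rewrite -/(T n); elim: n => [|n IHn].
  by rewrite /T big_ord1 subnn isqrt_coef0 mulr1.
apply: (mulfI (_ : n.+1%:R != 0)); first by rewrite pnatr_eq0.
by rewrite -TM MS TM IHn !mulr1 natr1.
Qed.

Definition isqrt_poly N : {poly R} := \poly_(k < N) a k.

Lemma coef_isqrt_poly_ge0 N i : 0 <= (isqrt_poly N)`_i.
Proof. by rewrite coef_poly; case: ifP => // _; rewrite ltW ?isqrt_coef_gt0. Qed.

(** The square of the truncation has coefficients 1 below degree N and nonnegative ones after, so it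
    dominates the geometric sum. *)
Lemma isqrt_poly_sqr_ge N v : 0 <= v -> v < 1 ->
  (1 - v ^+ N) / (1 - v) <= (isqrt_poly N).[v] ^+ 2.
Proof.
move=> v0 v1; have v1' : 1 - v != 0 by rewrite subr_eq0 gt_eqF.
have -> : (1 - v ^+ N) / (1 - v) = (\poly_(k < N) 1).[v].
  apply: (mulIf v1'); rewrite divfK // horner_poly.
  under eq_bigr do rewrite mul1r.
  by rewrite -opprB subrX1 -mulNr opprB mulrC.
rewrite -horner_exp -subr_ge0 -hornerN -hornerD horner_nneg_coef // => i.
rewrite coefB coef_poly expr2 coefM subr_ge0; case: ltnP => [ltiN|_]; last first.
  by apply: sumr_ge0 => j _; rewrite mulr_ge0 ?coef_isqrt_poly_ge0.
rewrite -(isqrt_coef_convolution i) ler_sum // => j _; rewrite !coef_poly.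
have -> : (j < N)%N by apply: leq_trans (ltn_ord j) ltiN.
by rewrite (leq_ltn_trans (leq_subr _ _) ltiN).
Qed.

Lemma pint_isqrt_poly N :
  pint (isqrt_poly N \Po ('X *+ 2 - 1) ^+ 2) = \sum_(k < N) a k / (2 * k%:R + 1).
Proof.
rewrite /isqrt_poly poly_def linear_sum linear_sum /=; apply: eq_bigr => k _.
rewrite linearZ linearZ /= rmorphXn /= comp_polyX -exprM; congr (_ * _).
set u : {poly R} := 'X *+ 2 - 1; set m := (2 * k)%N.
have du : u^`() = 2%:R.
  by rewrite /u derivB derivMn derivX -polyC1 derivC subr0.
have E : pint (u ^+ m.+1)^`() = (m.+1%:R * 2) * pint (u ^+ m).
  rewrite deriv_exp du /= -linearZ /=; congr (pint _).
  by rewrite -mul_polyC polyCM !polyC_natr -mulr_natl mulrA.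
have : m.+1%:R * 2 * pint (u ^+ m) = 2.
  have u1 : u.[1] = 1 by rewrite !hornerE; ring.
  have u0 : u.[0] = -1 by rewrite !hornerE; ring.
  rewrite -E pint_deriv !horner_exp u1 u0 expr1n.
  by rewrite exprS exprM sqrrN expr1n expr1n mulr1 opprK.
have mE : m.+1%:R = 2 * k%:R + 1 :> R by rewrite -addn1 natrD natrM.
rewrite mE => E2; have k0 : (2 * k%:R + 1 : R) != 0.
  by rewrite gt_eqF // ltr_wpDl ?mulr_ge0 ?ler0n.
apply: (mulfI k0); apply: (mulIf (_ : (2 : R) != 0)); first by rewrite pnatr_eq0.
by rewrite divff // mul1r -[RHS]E2; ring.
Qed.

(* The series sums to pi/2; the factor (30k+8)/(30k+3) approximates the tail
   divided by its first coefficient well enough to telescope. *)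
Lemma sum_isqrt_coef_le N :
  \sum_(k < N) a k / (2 * k%:R + 1) <= 1076 / 685.
Proof.
pose U m : R := \sum_(k < m) a k / (2 * k%:R + 1).
pose V m : R := U m + a m * ((30 * m%:R + 8) / (30 * m%:R + 3)).
have VS m : V m.+1 <= V m.
  rewrite /V /U big_ord_recr /= -addrA lerD2l isqrt_coefS -mulrA -mulrDr.
  rewrite ler_pM2l ?isqrt_coef_gt0 // -[m.+1%:R]natr1.
  have : (0 : R) <= m%:R by rewrite ler0n.
  move: (m%:R : R) => x x0.
  rewrite -subr_ge0.
  (* The numerator expands to the constant 216: with 30, 8 and 3 every positive power of [x]
     cancels. *)
  have -> : (30 * x + 8) / (30 * x + 3) -
      ((2 * x + 1)^-1 + (2 * x + 1) / (2 * x + 2) * ((30 * (x + 1) + 8) / (30 * (x + 1) + 3)))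
      = ((30 * x + 8) * ((2 * x + 1) * (2 * x + 2) * (30 * x + 33))
         - (30 * x + 3) * (2 * x + 2) * (30 * x + 33)
         - (30 * x + 3) * (2 * x + 1) ^+ 2 * (30 * x + 38))
        / ((30 * x + 3) * (2 * x + 1) * (2 * x + 2) * (30 * x + 33)).
    field; do ?[apply/andP; split]; apply: lt0r_neq0; lra.
  apply: divr_ge0; last by rewrite !mulr_ge0 //; lra.
  nra.
have VN m : V (m + 8)%N <= V 8%N.
  by elim: m => // m IHm; rewrite addSn (le_trans (VS _)).
have UV m : U m <= V m.
  have m0 : (0 : R) <= m%:R by rewrite ler0n.
  have g0 : 0 <= (30 * m%:R + 8) / (30 * m%:R + 3) :> R by apply: divr_ge0; lra.
  by rewrite /V lerDl mulr_ge0 // ltW ?isqrt_coef_gt0.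
have UN m : U N <= U (N + m)%N.
  elim: m => [|m IHm]; first by rewrite addn0.
  have m0 : (0 : R) <= (N + m)%:R by rewrite ler0n.
  have k0 : (0 : R) <= 2 * (N + m)%:R + 1 by lra.
  rewrite addnS (le_trans IHm) // /U [leRHS]big_ord_recr lerDl; apply: divr_ge0 k0.
  by rewrite ltW ?isqrt_coef_gt0.
(* Eight exact terms suffice: 1076/685 exceeds pi/2 by less than 10^-5. *)
suff V8 : V 8%N <= 1076 / 685.
  exact: le_trans (UN 8%N) (le_trans (UV _) (le_trans (VN _) V8)).
have e1 : a 1 = 1 / 2 by rewrite isqrt_coefS isqrt_coef0; field.
have e2 : a 2 = 3 / 8 by rewrite isqrt_coefS e1; field.
have e3 : a 3 = 5 / 16 by rewrite isqrt_coefS e2; field.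
have e4 : a 4 = 35 / 128 by rewrite isqrt_coefS e3; field.
have e5 : a 5 = 63 / 256 by rewrite isqrt_coefS e4; field.
have e6 : a 6 = 231 / 1024 by rewrite isqrt_coefS e5; field.
have e7 : a 7 = 429 / 2048 by rewrite isqrt_coefS e6; field.
have e8 : a 8 = 429 / 2048 * (15 / 16) by rewrite isqrt_coefS e7; field.
have U8 : U 8%N = 1 + 1 / 6 + 3 / 40 + 5 / 112 + 35 / 1152 + 63 / 2816
    + 231 / 1024 / 13 + 429 / 2048 / 15.
  by rewrite /U !big_ord_recr big_ord0 /= isqrt_coef0 e1 e2 e3 e4 e5 e6 e7; field.
have V8E : V 8%N = 1 + 1 / 6 + 3 / 40 + 5 / 112 + 35 / 1152 + 63 / 2816
    + 231 / 1024 / 13 + 429 / 2048 / 15 + 429 / 2048 * (15 / 16) * (248 / 243).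
  by rewrite /V U8 e8; field.
by rewrite V8E; lra.
Qed.

End InverseSqrtSeries.

(** * The Gauss--Legendre distribution *)

Lemma exp_small_seq (R : realType) (t : seq R) (d : R) : 0 < d ->
    (forall y, y \in t -> 0 <= y < 1) ->
  exists N, forall y, y \in t -> y ^+ N <= d.
Proof.
move=> d0; elim: t => [|y t IH] t01; first by exists 0%N.
have [|N HN] := IH; first by move=> z zt; rewrite t01 // inE zt orbT.
have /andP[y0 y1] := t01 y (mem_head _ _).
have /cvgrPdist_le /(_ d d0) [M _ HM] : (fun k => y ^+ k) @ \oo --> (0 : R).
  by apply: cvg_expr; rewrite ger0_norm.
exists (maxn N M) => z zt; have /andP[z0 z1] := t01 z zt.
move: zt; rewrite inE => /predU1P[->|zt].
  have := HM (maxn N M) (leq_maxr _ _).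
  by rewrite sub0r normrN ger0_norm // exprn_ge0.
by apply: le_trans (HN z zt); apply: ler_wiXn2l; rewrite ?leq_maxl // ltW.
Qed.

Section GaussLegendre.
Variables (R : realType) (n : nat) (s : seq R).
Hypotheses (uniq_s : uniq s) (size_s : size s = n).
Hypothesis s_itv : forall x, x \in s -> 0 < x < 1.
Hypothesis s_root : all (root (legendre R n)) s.
Hypothesis n_gt0 : (0 < n)%N.

Let w := @gauss_weight R n.

(** This is Z, the quadrature value of 1 / sqrt (x (1 - x)). *)
Definition gauss_norm : R :=
  (legendre R n).[0] ^+ 2 * \sum_(x <- s) w x / Num.sqrt (x * (1 - x)).

Lemma sqrt_node_gt0 x : x \in s -> 0 < Num.sqrt (x * (1 - x)).
Proof. by move=> /s_itv/andP[x0 x1]; rewrite sqrtr_gt0 mulr_gt0 ?subr_gt0. Qed.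

Lemma w_gt0 x : x \in s -> 0 < w x.
Proof. exact: (gauss_weight_gt0 uniq_s size_s s_itv s_root). Qed.

Lemma legendre0_sqr_gt0 : 0 < (legendre R n).[0] ^+ 2.
Proof.
rewrite legendre0 exprn_even_gt0 //= mulrn_eq0 negb_or -lt0n fact_gt0.
by rewrite signr_eq0.
Qed.

Lemma gauss_norm_gt0 : 0 < gauss_norm.
Proof.
rewrite mulr_gt0 ?legendre0_sqr_gt0 //.
case: s size_s uniq_s s_itv s_root w_gt0 sqrt_node_gt0 n_gt0 => [<- //|x t] _ _ _ _ w0 q0 _.
rewrite big_cons ltr_pwDl ?divr_gt0 ?w0 ?q0 ?mem_head // big_seq sumr_ge0 // => y yt.
by rewrite ltW // divr_gt0 // ?w0 ?q0 // inE yt orbT.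
Qed.

(** With v = (2x - 1)^2 one has 1 - v = 4x (1 - x). A long enough truncation is at least (1 - d) (1
    - v)^(-1/2) at every node, so [gauss_le_pint] bounds (1 - d) Z for every d in (0, 1). *)
Lemma gauss_norm_le : gauss_norm <= 2152 / 685.
Proof.
suff H (d : R) : 0 < d -> d < 1 -> (1 - d) * gauss_norm <= 2152 / 685.
  rewrite leNgt; apply/negP; move: (gauss_norm) (gauss_norm_gt0) H => Z Z0 H K.
  (* Chosen so that d Z is half of the supposed excess of Z. *)
  pose d := (Z - 2152 / 685) / (2 * Z).
  have dE : d * Z = (Z - 2152 / 685) / 2 by rewrite /d; field; rewrite gt_eqF.
  have d0 : 0 < d by rewrite divr_gt0 ?subr_gt0 ?mulr_gt0.
  have d1 : d < 1 by rewrite /d ltr_pdivrMr ?mulr_gt0 // mul1r; lra.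
  by have := H d d0 d1; rewrite mulrBl mul1r dE; lra.
move=> d0 d1.
have [|N HN] := @exp_small_seq R [seq (x *+ 2 - 1) ^+ 2 | x <- s] d d0.
  move=> _ /mapP[x /s_itv/andP[x0 x1] ->]; rewrite sqr_ge0 /=; nra.
have := gauss_le_pint uniq_s size_s s_itv s_root n_gt0 (coef_isqrt_poly_ge0 R N).
rewrite pint_isqrt_poly => /le_trans /(_ (sum_isqrt_coef_le R N)) S_le.
suff : (1 - d) / 2 * gauss_norm <= 1076 / 685 by lra.
apply: le_trans S_le; rewrite /gauss_norm mulrCA ler_wpM2l ?sqr_ge0 //.
rewrite mulr_sumr !big_seq ler_sum // => x xs; rewrite mulrCA.
apply: ler_wpM2l; first by rewrite ltW ?w_gt0.
have /andP[x0 x1] := s_itv xs; set v := (x *+ 2 - 1) ^+ 2.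
have r0 := sqrt_node_gt0 xs; set r := Num.sqrt _ in r0 *.
have r2 : r ^+ 2 = x * (1 - x) by rewrite sqr_sqrtr // mulr_ge0 ?subr_ge0 // ltW.
have v1 : 1 - v = 4 * r ^+ 2 by rewrite r2 /v; ring.
have r20 : 0 < r ^+ 2 by rewrite exprn_gt0.
have vd : v ^+ N <= d by apply: HN; apply/mapP; exists x.
have Sv : (1 - v ^+ N) / (1 - v) <= (isqrt_poly R N).[v] ^+ 2.
  by apply: isqrt_poly_sqr_ge; [rewrite sqr_ge0 | lra].
have S0 : 0 <= (isqrt_poly R N).[v].
  by apply: horner_nneg_coef; [exact: coef_isqrt_poly_ge0|rewrite sqr_ge0].
rewrite -(@ler_pXn2r _ 2) ?nnegrE //; last by rewrite divr_ge0 ?divr_ge0 ?ltW // subr_gt0.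
apply: le_trans Sv; rewrite v1 -[leLHS]/(((1 - d) / 2 / r) ^+ 2).
have -> : ((1 - d) / 2 / r) ^+ 2 = (1 - d) ^+ 2 / (4 * r ^+ 2).
  by field; rewrite gt_eqF.
rewrite ler_pM2r ?invr_gt0 ?mulr_gt0 //; nra.
Qed.

(** Under u = 2t - 1, u^2 - 1 = 4 (t^2 - t) gives 4^n, and the chain rule takes back 2^n. *)
Lemma Ltil_legendre : Ltil R n = 2 ^+ n *: legendre R n.
Proof.
pose q : {poly R} := 2%:R *: 'X - 1.
have dq : q^`() = 2%:P.
  by rewrite /q derivB derivZ derivX -polyC1 derivC subr0 alg_polyC.
have derivn_comp (p : {poly R}) j : (p \Po q)^`(j) = 2 ^+ j *: (p^`(j) \Po q).
  elim: j => [|j IHj]; first by rewrite expr0 scale1r.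
  rewrite derivnS IHj derivZ deriv_comp dq derivnS.
  by rewrite mulrC mul_polyC scalerA -exprSr.
have := derivn_comp (('X ^+ 2 - 1) ^+ n) n.
have -> : ('X ^+ 2 - 1) ^+ n \Po q = 4 ^+ n *: rodrigues R n.
  rewrite rmorphXn rmorphB rmorphXn rmorph1 /= comp_polyX /rodrigues -exprZn.
  by congr (_ ^+ _); rewrite /q -!mul_polyC !polyC_natr; ring.
rewrite derivnZ -/(legendre R n) -/q -/(Ltil R n) => E.
have t0 : (2 : R) ^+ n != 0 by rewrite expf_neq0 // pnatr_eq0.
apply: (scalerI t0); rewrite -E scalerA -exprMn; congr (_ ^+ _ *: _); ring.
Qed.

Lemma root_legendre_mem x : root (legendre R n) x = (x \in s).
Proof.
apply/idP/idP => [rx|]; last exact: (allP s_root).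
apply: contraLR isT => xs.
have := @roots_geq_poly_eq0 _ (legendre R n) (x :: s).
rewrite /= rx s_root xs uniq_s size_s size_legendre leqnn => /(_ isT isT isT) L0.
by have := size_legendre R n; rewrite L0 size_poly0.
Qed.

Variable c : nat.
Hypothesis c2n : c = n.*2.

Lemma GLsupportE : @GLsupport R c = [set` s].
Proof.
rewrite /GLsupport c2n doubleK Ltil_legendre; apply/seteqP; split=> x /=;
by rewrite rootZ ?root_legendre_mem // expf_neq0 // pnatr_eq0.
Qed.

(** The exponent 3/2 = 1 + 1/2 splits into the Gauss weight and an extra 1 / sqrt (x (1 - x)); the
    constant 4^-n cancels in [Exp]. *)
Lemma GLweightE x : x \in s ->
  GLweight c x = 4 ^- n * (w x / Num.sqrt (x * (1 - x))).
Proof.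
move=> xs; have /andP[x0 x1] := s_itv xs.
have y0 : 0 < x * (1 - x) by rewrite mulr_gt0 ?subr_gt0.
rewrite /GLweight /w /gauss_weight c2n doubleK Ltil_legendre derivZ hornerZ.
have -> : (x * (1 - x)) `^ (3%:R / 2%:R) = x * (1 - x) * Num.sqrt (x * (1 - x)).
  have -> : 3%:R / 2%:R = 1 + 2^-1 :> R by field.
  by rewrite powRD ?gt_eqF ?implybT // powRr1 ?powR12_sqrt // ltW.
rewrite exprMn -exprM mulnC exprM -(natrX _ 2 2) !invfM -!invfM; congr (_^-1); ring.
Qed.

(** The square root in [g] cancels the one in the weights, leaving the exact quadrature of [q]. *)
Lemma Exp_gauss (g : R -> R) (q : {poly R}) : (size q <= n.*2)%N ->
    (forall x, x \in s -> g x = q.[x] * Num.sqrt (x * (1 - x))) ->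
  Exp (@GLsupport R c) (GLweight c) g = pint q / gauss_norm.
Proof.
move=> sq gq; rewrite /Exp GLsupportE -!fsbig_seq //.
rewrite (gauss_quadrature uniq_s size_s s_itv s_root sq) /gauss_norm -/w.
have -> : \sum_(x <- s) GLweight c x * g x = 4 ^- n * \sum_(x <- s) w x * q.[x].
  rewrite mulr_sumr !big_seq; apply: eq_bigr => x xs.
  rewrite GLweightE // gq // [q.[x] * _]mulrC mulrA -[_ * _ * Num.sqrt _]mulrA.
  by rewrite divfK ?gt_eqF ?sqrt_node_gt0 // mulrA.
have -> : \sum_(x <- s) GLweight c x
    = 4 ^- n * \sum_(x <- s) w x / Num.sqrt (x * (1 - x)).
  by rewrite mulr_sumr !big_seq; apply: eq_bigr => x xs; rewrite GLweightE.
have := legendre0_sqr_gt0; have := gauss_norm_gt0; rewrite /gauss_norm.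
move: (\sum_(x <- s) _) (\sum_(x <- s) _) (_.[0] ^+ 2) => u z C Cz C0.
have z0 : z != 0 by apply/eqP => zE; rewrite zE mulr0 ltxx in Cz.
field; rewrite z0 gt_eqF //= expf_neq0 // pnatr_eq0 //.
Qed.

Lemma fTardos_deriv l k x : (k <= l)%N -> 0 < x < 1 ->
  fTardos l k x
    = ('X ^+ k * (1 - 'X) ^+ (l - k) : {poly R})^`().[x] * Num.sqrt (x * (1 - x)).
Proof.
move=> lekl /andP[x0 x1]; rewrite /fTardos; set m := (l - k)%N.
have y0 : 0 < x * (1 - x) by rewrite mulr_gt0 ?subr_gt0.
set r := Num.sqrt (x * (1 - x)); have r0 : 0 < r by rewrite sqrtr_gt0.
have r2 : r ^+ 2 = x * (1 - x) by rewrite sqr_sqrtr // ltW.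
have sig y : 0 < y -> 0 < 1 - y -> sigma y = (1 - y) / Num.sqrt (y * (1 - y)).
  move=> y00 y10; rewrite /sigma.
  have -> : (1 - y) / y = ((1 - y) / Num.sqrt (y * (1 - y))) ^+ 2.
    rewrite exprMn exprVn sqr_sqrtr ?mulr_ge0 ?ltW //.
    by field; rewrite !gt_eqF.
  by rewrite sqrtr_sqr ger0_norm // divr_ge0 ?sqrtr_ge0 ?ltW.
rewrite !sig ?subKr ?subr_gt0 // [(1 - x) * x]mulrC -/r.
have dE : ('X ^+ k * (1 - 'X) ^+ m : {poly R})^`().[x]
    = (x ^+ k.-1 *+ k) * (1 - x) ^+ m - x ^+ k * ((1 - x) ^+ m.-1 *+ m).
  rewrite derivM !deriv_exp derivX derivB derivX -polyC1 derivC sub0r mul1r mulN1r.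
  by rewrite mulNrn mulrN !(hornerE, hornerMn, horner_exp).
(* Holds for j = 0 too, where [j.-1] is 0, so k = 0 and m = 0 need no separate treatment. *)
have ek (y : R) j : y ^+ j *+ j = (y ^+ j.-1 *+ j) * y.
  by case: j => [|j]; rewrite ?mulr0n ?mul0r // mulrnAl -exprSr.
have rn0 : r != 0 by rewrite gt_eqF.
apply: (mulIf rn0); rewrite dE -[RHS]mulrA -[r * r]expr2 r2.
transitivity ((x ^+ k *+ k) * (1 - x) ^+ m * (1 - x)
   - x ^+ k * ((1 - x) ^+ m *+ m) * x); last by rewrite !ek; ring.
rewrite -[x ^+ k *+ k]mulr_natr -[_ ^+ m *+ m]mulr_natr.
move: (x ^+ k) ((1 - x) ^+ m) (k%:R : R) (m%:R : R) => u v a b; by field.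
Qed.

Lemma pint_bernstein_deriv l k : (0 < l)%N -> (k < l)%N ->
  pint ('X ^+ k * (1 - 'X) ^+ (l - k) : {poly R})^`() = - (k == 0)%:R.
Proof.
move=> l0 kl; rewrite pint_deriv !(hornerE, horner_exp) subrr expr1n.
rewrite !expr0n subn_eq0 leqNgt kl /= mulr0 sub0r subr0 expr1n mulr1.
by [].
Qed.

Lemma size_bernstein_deriv l k : (k <= l)%N ->
  (size ('X ^+ k * (1 - 'X) ^+ (l - k) : {poly R})^`()%R <= l)%N.
Proof.
move=> kl; apply: leq_trans (size_poly _ _) _.
have s2 : size (1 - 'X : {poly R})%R = 2%N.
  by rewrite -opprB size_polyN -polyC1 size_XsubC.
have := size_poly_exp_leq (1 - 'X : {poly R}) (l - k); rewrite s2 mul1n.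
have := size_polyMleq ('X ^+ k : {poly R}) ((1 - 'X) ^+ (l - k)).
rewrite size_polyXn; set A : {poly R} := _ * _; set B : {poly R} := _ ^+ (l - k).
by move: (size A) (size B) => p q; lia.
Qed.

(** As l <= c = 2n, the derivative is integrated exactly and gives a difference of values at 1 and
    0, nonzero only for k = 0. *)
Lemma Exp_fTardos l k : (0 < l <= c)%N -> (k < l)%N ->
  Exp (@GLsupport R c) (GLweight c) (fTardos l k) = - (k == 0)%:R / gauss_norm.
Proof.
move=> /andP[l0 lc] kl; rewrite -(pint_bernstein_deriv l0 kl).
apply: Exp_gauss; first by rewrite -c2n (leq_trans (size_bernstein_deriv (ltnW kl))).
by move=> x /s_itv; apply: fTardos_deriv; apply: ltnW.
Qed.

Lemma calR_gauss l : (0 < l <= c)%N ->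
  calR (@GLsupport R c) (GLweight c) l = gauss_norm^-1.
Proof.
move=> lc; have /andP[l0 _] := lc; rewrite /calR big_nat_cond big1 ?subr0.
  have -> : Exp (@GLsupport R c) (GLweight c) (fun p => - fTardos l 0 p)
      = - Exp (@GLsupport R c) (GLweight c) (fTardos l 0).
    rewrite /Exp -mulNr GLsupportE -!fsbig_seq // -sumrN; congr (_ / _).
    by apply: eq_bigr => x _; rewrite mulrN.
  by rewrite Exp_fTardos // mulNr opprK mul1r.
move=> k /andP[/andP[k0 kl] _].
by rewrite /Rlx Exp_fTardos // gtn_eqF // oppr0 mul0r maxxx mulr0.
Qed.

Lemma calRmin_gauss : calRmin R c = gauss_norm^-1.
Proof.
(* The default of the minimum is the value at l = 1, which lies in the range because c > 0. *)
have c0 : (0 < c)%N by rewrite c2n double_gt0.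
rewrite /calRmin big_nat_cond.
apply: (big_ind (fun z => z = gauss_norm^-1)) => [|x y -> ->|l /andP[/andP[l0 lc] _]].
- exact: calR_gauss.
- exact: minxx.
- by apply: calR_gauss; rewrite l0.
Qed.

End GaussLegendre.

(** * The smallest zero of the Legendre polynomial *)

Section SmallestRoot.
Variables (R : rcfType) (n : nat).
Hypothesis n_gt0 : (0 < n)%N.

(** With p = z / N, the ratio of consecutive terms of the expansion at 0 tends in absolute value to
    z / (k + 1)^2, as in the series of J_0(2 sqrt z). *)
Definition legendre_scale : R := n%:R * n.+1%:R.
Local Notation N := legendre_scale.

Definition legendre_term (z : R) k : R :=
  ('C(n, k) * 'C(n + k, k))%:R * (z / N) ^+ k.

Lemma legendre_scale_gt0 : 0 < N.
Proof. by rewrite mulr_gt0 ?ltr0n. Qed.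

(** Rests on n (n + 1) - k (k + 1) = (n - k) (n + k + 1). *)
Lemma legendre_termS z k : (k <= n)%N ->
  legendre_term z k.+1 * k.+1%:R ^+ 2
    = legendre_term z k * (z * (1 - (k * k.+1)%:R / N)).
Proof.
move=> lekn; have N0 : N != 0 by rewrite gt_eqF ?legendre_scale_gt0.
have c_rec : ('C(n, k.+1) * 'C(n + k.+1, k.+1))%:R * k.+1%:R ^+ 2
    = ('C(n, k) * 'C(n + k, k))%:R * (N - (k * k.+1)%:R) :> R.
  have -> : N - (k * k.+1)%:R = ((n - k) * (n + k.+1))%:R :> R.
    rewrite !natrM natrB // natrD /legendre_scale -[n.+1%:R]natr1 -[k.+1%:R]natr1.
    ring.
  rewrite -natrX -!natrM; congr (_%:R).
  have e1 := mul_bin_left n k; have e2 := mul_bin_diag (n + k.+1) k.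
  rewrite addnS /= in e2 *; nia.
rewrite /legendre_term exprS.
have -> : z * (1 - (k * k.+1)%:R / N) = (N - (k * k.+1)%:R) * (z / N) by field.
rewrite [RHS]mulrACA -c_rec; ring.
Qed.

Lemma legendre_term0 z : legendre_term z 0 = 1.
Proof. by rewrite /legendre_term !bin0 expr0 mulr1. Qed.

Lemma legendre_term_ge0 z k : 0 <= z -> 0 <= legendre_term z k.
Proof.
move=> z0; rewrite mulr_ge0 ?ler0n // exprn_ge0 // divr_ge0 // ltW //.
exact: legendre_scale_gt0.
Qed.

Lemma legendre_term_decr z k : 0 <= z -> z <= k.+1%:R ^+ 2 ->
  legendre_term z k.+1 <= legendre_term z k.
Proof.
move=> z0 zk; have [lekn|ltnk] := leqP k n; last first.
  by rewrite {1}/legendre_term bin_small ?mul0n ?mul0r ?legendre_term_ge0 // ltnW.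
have k0 : 0 < k.+1%:R ^+ 2 :> R by rewrite exprn_gt0.
rewrite -(ler_pM2r k0) legendre_termS //; apply: ler_wpM2l; first exact: legendre_term_ge0.
apply: le_trans zk; rewrite ler_piMr // gerBl divr_ge0 ?ler0n //.
by rewrite ltW ?legendre_scale_gt0.
Qed.

Definition legendre_alt (z : R) m : R := \sum_(k < m) (-1) ^+ k * legendre_term z k.

(** Terms beyond n vanish, so any m > n gives the full sum; its parity can then suit the
    truncation. *)
Lemma legendre_horner z m : (n < m)%N ->
  (legendre R n).[z / N] = ((-1) ^+ n *+ n`!) * legendre_alt z m.
Proof.
move=> ltnm; rewrite (@horner_coef_wide _ m) ?size_legendre // mulr_sumr.
apply: eq_bigr => k _; rewrite coef_legendre /legendre_term.
have [lekn|ltnk] := leqP k n; last by rewrite bin_small // mulr0n mul0rn !(mul0n, mul0r, mulr0).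
rewrite -bin_ffact -(bin_sub (leq_addr k n)) addKn.
rewrite -signr_odd oddB // signr_addb !signr_odd natrM.
rewrite -(mulr_natr (_ *+ 'C(n, k))) -(mulr_natr _ 'C(n, k)) -(mulr_natr _ n`!) natrM.
move: ((-1) ^+ n) ((-1) ^+ k) ((z / N) ^+ k) (n`!%:R) => u v w f.
move: ('C(n, k)%:R) ('C(n + k, k)%:R) => b d; ring.
Qed.

(** Leibniz's argument: for z <= 4 the terms do not increase from index 1 on, so after an odd number
    of terms each further pair contributes at most 0. *)
Lemma legendre_alt_le z m j : 0 <= z -> z <= 4 -> odd m -> (0 < m)%N ->
  legendre_alt z (m + j.*2) <= legendre_alt z m.
Proof.
move=> z0 z4 om m0; elim: j => [|j IHj]; first by rewrite addn0.
apply: le_trans IHj; rewrite doubleS !addnS /legendre_alt !big_ord_recr /=.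
rewrite -addrA gerDl exprS -signr_odd oddD odd_double addbF om expr1.
rewrite mulrNN mul1r mulN1r addrC subr_le0 mul1r legendre_term_decr //.
by apply: le_trans z4 _; rewrite -natrX ler_nat; nia.
Qed.

(** Here m = 0 is excluded because term 1 may exceed term 0. *)
Lemma legendre_alt_ge z m j : 0 <= z -> z <= 4 -> ~~ odd m -> (0 < m)%N ->
  legendre_alt z m <= legendre_alt z (m + j.*2).
Proof.
move=> z0 z4 om m0; elim: j => [|j IHj]; first by rewrite addn0.
apply: le_trans IHj _; rewrite doubleS !addnS /legendre_alt !big_ord_recr /=.
rewrite -addrA lerDl exprS -signr_odd oddD odd_double addbF (negPf om) expr0.
rewrite mulr1 mul1r mulN1r subr_ge0 legendre_term_decr //.
by apply: le_trans z4 _; rewrite -natrX ler_nat; nia.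
Qed.

Lemma legendre_terms z : (4 <= n)%N ->
  let rho k := 1 - k / N in
  [/\ legendre_term z 1 = z,
      legendre_term z 2 = z ^+ 2 / 4 * rho 2,
      legendre_term z 3 = z ^+ 3 / 36 * (rho 2 * rho 6),
      legendre_term z 4 = z ^+ 4 / 576 * (rho 2 * rho 6 * rho 12) &
      legendre_term z 5 = z ^+ 5 / (36 * 400) * (rho 2 * rho 6 * rho 12 * rho 20)].
Proof.
move=> n4 rho.
have step k : (k <= 4)%N -> legendre_term z k.+1
    = legendre_term z k * (z * (1 - (k * k.+1)%:R / N)) / k.+1%:R ^+ 2.
  by move=> k4; rewrite -legendre_termS ?(leq_trans k4) // mulfK // expf_neq0 ?pnatr_eq0.
have e1 : legendre_term z 1 = z.
  by rewrite step // legendre_term0 mul0n mul0r subr0 mul1r mulr1 expr1n divr1.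
have e2 : legendre_term z 2 = z ^+ 2 / 4 * rho 2.
  by rewrite step // e1 /rho; move: (N^-1) => i; field.
have e3 : legendre_term z 3 = z ^+ 3 / 36 * (rho 2 * rho 6).
  by rewrite step // e2 /rho; move: (N^-1) => i; field.
have e4 : legendre_term z 4 = z ^+ 4 / 576 * (rho 2 * rho 6 * rho 12).
  by rewrite step // e3 /rho; move: (N^-1) => i; field.
by split=> //; rewrite step // e4 /rho; move: (N^-1) => i; field.
Qed.

Lemma legendre_scale_ge : (100 <= n)%N -> (100 * 100) <= N.
Proof.
move=> n100; have : 100 <= n%:R :> R by rewrite (ler_nat _ 100).
by rewrite /legendre_scale -natr1; nra.
Qed.

(** The bound 1.445 lies just below the first zero of the limit series. Six terms bound the sum from
    below; their limit polynomial stays above 2/10^4, and the corrections in 1/N cost less. *)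
Lemma legendre_neq0_small z : (100 <= n)%N -> 0 <= z -> z <= 289 / 200 ->
  (legendre R n).[z / N] != 0.
Proof.
move=> n100 z0 zle; have n4 : (4 <= n)%N by apply: leq_trans n100.
rewrite (@legendre_horner _ (6 + n.*2)); last by lia.
rewrite mulf_neq0 ?mulrn_eq0 ?negb_or ?signr_eq0 -?lt0n ?fact_gt0 //.
rewrite gt_eqF // (lt_le_trans _ (legendre_alt_ge n z0 _ _ _)) //; last by lra.
rewrite /legendre_alt !big_ord_recr big_ord0 /= legendre_term0.
have [-> -> -> -> ->] := legendre_terms z n4.
have Nge := legendre_scale_ge n100; have N0 := legendre_scale_gt0.
have i0 : 0 < N^-1 by rewrite invr_gt0.
have ile : N^-1 <= 1 / (100 * 100) by rewrite div1r lef_pV2 ?posrE //; lra.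
move: (N^-1) i0 ile => i i0 ile {Nge N0}.
have r1 : (1 - 2 * i) * (1 - 6 * i) <= 1 by nra.
have r2 : 1 - 20 * i <= (1 - 2 * i) * (1 - 6 * i) * (1 - 12 * i) by nra.
have r3 : (1 - 2 * i) * (1 - 6 * i) * (1 - 12 * i) * (1 - 20 * i) <= 1.
  have : 0 <= (1 - 2 * i) * (1 - 6 * i) by nra.
  by move: ((1 - 2 * i) * (1 - 6 * i)) r1 => y *; nra.
have p3 : 0 <= z ^+ 3 by rewrite exprn_ge0.
have p4 : 0 <= z ^+ 4 by rewrite exprn_ge0.
have p5 : 0 <= z ^+ 5 by rewrite exprn_ge0.
have t3 := ler_wpM2l p3 r1; have t4 := ler_wpM2l p4 r2; have t5 := ler_wpM2l p5 r3.
have b2 : z ^+ 2 * i <= 21 / (100 * 1000) by nra.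
have b4 : z ^+ 4 * i <= 44 / (100 * 1000).
  have z2 : z ^+ 2 <= 21 / 10 by nra.
  have z20 : 0 <= z ^+ 2 by rewrite exprn_ge0.
  by rewrite -[z ^+ 4]/(z ^+ (2 * 2)) exprM; nra.
have T5 : 2 / (100 * 100)
    < 1 - z + z ^+ 2 / 4 - z ^+ 3 / 36 + z ^+ 4 / 576 - z ^+ 5 / (36 * 400).
  pose a : R := 289 / 200.
  (* Minus the divided difference between [z] and [a]; its nonnegativity reduces the bound to the
     endpoint [a]. *)
  pose Q := 1 - (z + a) / 4 + (z ^+ 2 + z * a + a ^+ 2) / 36
    - (z ^+ 3 + z ^+ 2 * a + z * a ^+ 2 + a ^+ 3) / 576
    + (z ^+ 4 + z ^+ 3 * a + z ^+ 2 * a ^+ 2 + z * a ^+ 3 + a ^+ 4) / (36 * 400).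
  have -> : 1 - z + z ^+ 2 / 4 - z ^+ 3 / 36 + z ^+ 4 / 576 - z ^+ 5 / (36 * 400)
      = 1 - a + a ^+ 2 / 4 - a ^+ 3 / 36 + a ^+ 4 / 576 - a ^+ 5 / (36 * 400)
        + (a - z) * Q by rewrite /Q /a; field.
  have Ta : 2 / (100 * 100)
      < 1 - a + a ^+ 2 / 4 - a ^+ 3 / 36 + a ^+ 4 / 576 - a ^+ 5 / (36 * 400).
    by rewrite /a; lra.
  have Q0 : 0 <= Q.
    have z2a : z ^+ 2 <= a ^+ 2 by rewrite ler_pXn2r ?nnegrE // /a; lra.
    have z3a : z ^+ 3 <= a ^+ 3 by rewrite ler_pXn2r ?nnegrE // /a; lra.
    by rewrite /Q; rewrite /a in z2a z3a *; nra.
  have : 0 <= (a - z) * Q by rewrite mulr_ge0 // subr_ge0.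
  lra.
rewrite expr0 expr1; lra.
Qed.

(** L(0) and L(3/N) share the factor (-1)^n n!, and five terms show that the alternating sum is at
    most 0 at z = 3, so the intermediate value theorem applies. *)
Lemma legendre_root_small : (100 <= n)%N ->
  exists2 x, 0 <= x <= 3 / N & root (legendre R n) x.
Proof.
move=> n100; have n4 : (4 <= n)%N by apply: leq_trans n100.
have N0 := legendre_scale_gt0.
have [||x xin rx] := @polyrcf.poly_ivt _ (legendre R n) 0 (3 / N); last first.
- by exists x => //; move: xin; rewrite in_itv.
- rewrite (@legendre_horner 3 (5 + n.*2)); last by lia.
  rewrite legendre0 mulrA -expr2 mulr_ge0_le0 ?sqr_ge0 //.
  have z4 : (3 : R) <= 4 by lra.
  apply: le_trans (@legendre_alt_le 3 5 n _ z4 _ _) _ => //.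
  rewrite /legendre_alt !big_ord_recr big_ord0 /= legendre_term0.
  have [-> -> -> -> _] := legendre_terms 3 n4.
  have Nge := legendre_scale_ge n100.
  have i0 : 0 < N^-1 by rewrite invr_gt0.
  have ile : N^-1 <= 1 / (100 * 100) by rewrite div1r lef_pV2 ?posrE //; lra.
  move: (N^-1) i0 ile => i i0 ile {Nge N0}.
  have r1 : 1 - 8 * i <= (1 - 2 * i) * (1 - 6 * i) by nra.
  have r2 : (1 - 2 * i) * (1 - 6 * i) * (1 - 12 * i) <= 1.
    have : 0 <= (1 - 2 * i) * (1 - 6 * i) <= 1 by apply/andP; split; nra.
    by move: ((1 - 2 * i) * (1 - 6 * i)) => y /andP[? ?]; nra.
  rewrite expr0 expr1; lra.
- by rewrite divr_ge0 // ltW.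
Qed.

End SmallestRoot.

(** * The function r *)

Section ExpBounds.
Variable R : realType.
Implicit Types x t : R.

(** From x^5/5! on, each term is at most 1/6 of the one before, so the tail is at most (x^5/120)
    (6/5) = x^5/100. *)
Lemma expR_le_poly5 x : 0 <= x -> x <= 1 ->
  expR x <= 1 + x + x ^+ 2 / 2 + x ^+ 3 / 6 + x ^+ 4 / 24 + x ^+ 5 / 96.
Proof.
move=> x0 x1; pose P := 1 + x + x ^+ 2 / 2 + x ^+ 3 / 6 + x ^+ 4 / 24.
have x50 : 0 <= x ^+ 5 by rewrite exprn_ge0.
have term j : x ^+ (5 + j) / (5 + j)`!%:R <= x ^+ 5 / 120 * (1 / 6) ^+ j.
  elim: j => [|j IHj]; first by rewrite addn0 expr0 mulr1.
  have -> : x ^+ (5 + j.+1) / (5 + j.+1)`!%:R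
      = x ^+ (5 + j) / (5 + j)`!%:R * (x / (5 + j).+1%:R).
    by rewrite addnS exprSr factS natrM invfM [_^-1 * _^-1]mulrC mulrACA.
  rewrite [(1 / 6) ^+ j.+1]exprSr [leRHS]mulrA; apply: ler_pM; [|by rewrite divr_ge0|exact: IHj|].
    by rewrite divr_ge0 // exprn_ge0.
  rewrite ler_pdivrMr ?ltr0n //; apply: le_trans x1 _.
  have : (6 : R) <= (5 + j).+1%:R by rewrite ler_nat.
  lra.
have partial j : series (exp_coeff x) (5 + j)%N
    <= P + x ^+ 5 / 100 * (1 - (1 / 6) ^+ j).
  elim: j => [|j IHj].
    rewrite addn0 expr0 subrr mulr0 addr0 /series /= /exp_coeff.
    rewrite !big_nat_recr //= big_nil /P.
    rewrite -[leLHS]/(0 + x ^+ 0 / 1 + x ^+ 1 / 1%:R + x ^+ 2 / 2 + x ^+ 3 / 6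
      + x ^+ 4 / 24) expr0 expr1; lra.
  rewrite addnS /series /= big_nat_recr //=.
  have := term j; rewrite /series /= in IHj.
  rewrite [(1 / 6) ^+ j.+1]exprSr -[exp_coeff x (5 + j)%N]/(x ^+ (5 + j) / (5 + j)`!%:R).
  move: IHj; move: (bigop _ _ _) (x ^+ (5 + j) / _) ((1 / 6) ^+ j) => S T q.
  lra.
rewrite /expR; apply: limr_le; first exact: is_cvg_series_exp_coeff.
near=> m.
have m5 : (5 <= m)%N by near: m; exists 5%N.
rewrite -(subnKC m5); apply: le_trans (partial _) _; rewrite lerD2l.
have : 0 <= (1 / 6 : R) ^+ (m - 5) by rewrite exprn_ge0 // divr_ge0.
by nra.
Unshelve. all: by end_near.
Qed.

Lemma rfun_le x : 0 < x -> x <= 1 ->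
  rfun x <= 1 / 2 + x / 6 + x ^+ 2 / 24 + x ^+ 3 / 96.
Proof.
move=> x0 x1; rewrite /rfun ler_pdivrMr ?exprn_gt0 //.
have := expR_le_poly5 (ltW x0) x1.
have -> : (1 / 2 + x / 6 + x ^+ 2 / 24 + x ^+ 3 / 96) * x ^+ 2
  = x ^+ 2 / 2 + x ^+ 3 / 6 + x ^+ 4 / 24 + x ^+ 5 / 96 by field.
lra.
Qed.

Lemma rfunE x : 0 < x -> x * rfun x = (expR x - 1 - x) / x.
Proof. by move=> x0; rewrite /rfun; field; rewrite gt_eqF. Qed.

(** Follows from 1 - x <= e^(-x). It forces x_2 to grow at least like a logarithm. *)
Lemma le_expR_rfun x : 0 < x -> x * rfun x <= expR x.
Proof.
move=> x0; rewrite rfunE // ler_pdivrMr //.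
have := expR_ge1Dx (- x); rewrite expRN => H.
have e0 := expR_gt0 x; have : (1 - x) * expR x <= 1.
  by rewrite -ler_pdivlMr // div1r.
by lra.
Qed.

(** For x > 0 the equation reads f x = 1, which x = 0 also satisfies. [a] is the minimum point of
    [f], so f a <= f 0 = 1, and e^b >= 1 + b^2/2 gives f b >= 1; searching to the right of a > 0
    avoids 0. *)
Lemma rfun_surj t : 0 < t -> exists x, 0 < x /\ x * rfun x = t.
Proof.
move=> t0; pose f x := expR x - (1 + t) * x.
have cf : continuous f.
  move=> x; apply: cvgB; first exact: continuous_expR.
  by apply: cvgM; [exact: cvg_cst|exact: cvg_id].
pose a := ln (1 + t); pose b := 2 * (1 + t).
have a0 : 0 < a by rewrite ln_gt0 // ltrDl.
have ab : a <= b.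
  by rewrite /a /b (le_trans (le_ln1Dx _)) //; lra.
have ea : expR a = 1 + t by rewrite lnK // posrE; lra.
have fa : f a <= 1.
  rewrite /f ea; have := expR_ge1Dx (- a); rewrite expRN ea => H.
  have : (1 - a) * (1 + t) <= 1 by rewrite -ler_pdivlMr ?div1r //; lra.
  lra.
have fb : 1 <= f b.
  have b0 : 0 <= b by rewrite /b; lra.
  have := expR_ge1Dxn 1 b0; rewrite /f.
  have -> : b ^+ 2 / 2`!%:R = (1 + t) * b.
    by rewrite -[2`!%:R]/(2 : R) /b; field.
  lra.
have [||x xab fx] := @IVT R f a b 1 ab; first exact: continuous_subspaceT.
  by rewrite ge_min fa le_max fb orbT.
move: xab; rewrite in_itv /= => /andP[ax xb].
have x0 : 0 < x by apply: lt_le_trans ax.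
exists x; split=> //; rewrite rfunE //.
have xn0 : x != 0 by rewrite gt_eqF.
by apply: (mulIf xn0); rewrite divfK //; move: fx; rewrite /f; lra.
Qed.

Lemma rfun_small x : 0 < x -> x <= 793 / (1250 * 5) ->
  rfun x <= 521 / 1000 + 84 / (100 * 1000).
Proof.
move=> x0 xle; have x1 : x <= 1 by lra.
apply: le_trans (rfun_le x0 x1) _.
have a0 : 0 <= 793 / (1250 * 5) :> R by lra.
have x2 : x ^+ 2 <= (793 / (1250 * 5)) ^+ 2 by rewrite ler_pXn2r ?nnegrE // ltW.
have x3 : x ^+ 3 <= (793 / (1250 * 5)) ^+ 3 by rewrite ler_pXn2r ?nnegrE // ltW.
by clear -xle x2 x3; lra.
Qed.

(* The limiting values of Z and y are pi and the inverse of the first zero of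
   the Bessel function J_0. *)
Lemma code_length_const Z y d x : 0 < Z -> Z <= 2152 / 685 ->
    0 < y -> y <= 416 / 1000 -> 0 <= d -> d <= 1 / (1000 * 1000) -> 0 < x ->
    x * rfun x = 1 / 2 * Z^-1 * y ->
  y * Z / ((1 / 2 - d) * x) < 206 / 10 + 2 / 1000.
Proof.
move=> Z0 Zle y0 yle d0 dle x0 xr.
have [K KE] : exists K : R, K = 206 / 10 + 2 / 1000 by eexists.
have [rho rhoE] : exists rho : R, rho = 521 / 1000 + 84 / (100 * 1000) by eexists.
rewrite -KE; have K0 : 0 < K by clear -KE; lra.
have rho0 : 0 < rho by clear -rhoE; lra.
have h0 : 0 < 1 / 2 - d by clear -dle; lra.
(* If the bound fails, [x] is so small that r(x) <= rho, and its equation gives K (1/2 - d) / 2 <=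
   Z^2 rho; but the left side is at least 5.15048 and the right at most 5.15040. *)
rewrite ltr_pdivrMr ?mulr_gt0 // ltNge; apply/negP => xle.
have hK : 1030 / 100 + 97 / (100 * 1000) <= K * (1 / 2 - d).
  apply: (@le_trans _ _ (K * (1 / 2 - 1 / (1000 * 1000)))).
    by clear -KE; rewrite KE; lra.
  by rewrite ler_pM2l // lerD2l lerN2.
have x_small : x <= 793 / (1250 * 5).
  have Zy : y * Z <= 416 / 1000 * (2152 / 685) by apply: ler_pM => //; exact: ltW.
  have : (1030 / 100 + 97 / (100 * 1000)) * x <= 416 / 1000 * (2152 / 685).
    by apply: le_trans Zy; apply: le_trans xle; rewrite mulrA ler_pM2r.
  by clear; lra.
have := rfun_small x0 x_small; rewrite -rhoE -(ler_pM2l x0) xr => H.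
have H2 : 1 / 2 * y <= x * rho * Z.
  have -> : 1 / 2 * y = 1 / 2 * Z^-1 * y * Z by field; rewrite gt_eqF.
  by rewrite ler_pM2r.
have H3 : K * (1 / 2 - d) * (1 / 2 * y) <= y * (Z * Z * rho).
  apply: (@le_trans _ _ (K * (1 / 2 - d) * (x * rho * Z))).
    by rewrite ler_pM2l // mulr_gt0.
  have -> : K * (1 / 2 - d) * (x * rho * Z) = K * ((1 / 2 - d) * x) * (Z * rho) by ring.
  have -> : y * (Z * Z * rho) = y * Z * (Z * rho) by ring.
  by rewrite ler_pM2r // mulr_gt0.
have ZZ : Z * Z * rho <= 2152 / 685 * (2152 / 685) * rho.
  by rewrite ler_pM2r //; apply: ler_pM => //; exact: ltW.
have H4 : K * (1 / 2 - d) * (1 / 2) <= Z * Z * rho.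
  by rewrite -(ler_pM2l y0); apply: le_trans H3; rewrite le_eqVlt; apply/orP; left; apply/eqP; ring.
by clear -hK H4 ZZ rhoE; rewrite rhoE in ZZ H4; lra.
Qed.
End ExpBounds.

(** * The code length *)

Section GaussLegendreParameters.
Variables (R : realType) (c : nat).
Hypotheses (c_even : ~~ odd c) (c_ge : (100 * 200 <= c)%N).

Lemma GL_parameters :
  (exists Z : R, [/\ 0 < Z, Z <= 2152 / 685 & calRmin R c = Z^-1]) /\
  289 / 200 / legendre_scale R c./2 <= GLp0 R c <= 3 / legendre_scale R c./2.
Proof.
have c2n : c = (c./2).*2 by rewrite even_halfK.
set n := c./2 in c2n *; have n100 : (100 <= n)%N by clear -c_ge c2n; lia.
have n0 : (0 < n)%N by apply: leq_trans n100.
have [s [us szs s01 rs]] := legendre_roots R n.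
have s_itv x : x \in s -> 0 < x < 1 by move/(allP s01).
have N0 := legendre_scale_gt0 R n0.
split.
  exists (gauss_norm n s); split.
  - exact: gauss_norm_gt0.
  - exact: gauss_norm_le.
  - exact: calRmin_gauss.
rewrite /GLp0 (GLsupportE us szs rs c2n).
have lb : lbound [set` s] (289 / 200 / legendre_scale R n).
  move=> x /= xs; rewrite leNgt; apply/negP => xlt.
  have /andP[x0 _] := s_itv _ xs.
  have : (legendre R n).[x] != 0.
    rewrite -[x](mulfK (lt0r_neq0 N0)) legendre_neq0_small //.
      by rewrite mulr_ge0 // ltW.
    by rewrite -ler_pdivlMr // ltW.
  by rewrite (rootP (allP rs _ xs)) eqxx.
have [x /andP[x0 xle] rx] := legendre_root_small R n0 n100.
have xs : x \in s by rewrite -(root_legendre_mem us szs rs).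
apply/andP; split.
  by apply: lb_le_inf => //; exists x.
by apply: le_trans xle; apply: ge_inf => //; exists (289 / 200 / legendre_scale R n).
Qed.

(** Here N = c (c + 2) / 4, so 1/p lies between c (c + 2) / 12 and 50/289 c (c + 2). As 50/289 <
    0.416^2, c >= 20000 absorbs the linear term. *)
Lemma sigma_GLp0_bounds : exists y : R,
  [/\ sigma (GLp0 R c) = y * c%:R, 1 / 4 <= y & y <= 416 / 1000].
Proof.
have [_ /andP[]] := GL_parameters; set p := GLp0 R c.
have cR : 100 * 200 <= c%:R :> R by rewrite -natrM ler_nat.
have -> : legendre_scale R c./2 = c%:R * (c%:R + 2) / 4.
  by rewrite /legendre_scale -{3 4}(even_halfK c_even) -natr1 -muln2 natrM; field.
move: (c%:R : R) cR => C C200 lo hi.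
have C0 : 0 < C by clear -C200; lra.
have M0 : 0 < C * (C + 2) / 4 by rewrite divr_gt0 // mulr_gt0 //; lra.
have a0 : 0 < 289 / 200 :> R by rewrite divr_gt0 ?ltr0n.
have b0 : 0 < 289 / 200 / (C * (C + 2) / 4) by exact: divr_gt0.
have p0 : 0 < p by exact: lt_le_trans lo.
have pV : C * (C + 2) / 12 <= p^-1.
  have -> : C * (C + 2) / 12 = (3 / (C * (C + 2) / 4))^-1.
    by field; rewrite !gt_eqF //; lra.
  by rewrite lef_pV2 ?posrE // divr_gt0.
have pV' : p^-1 <= 50 / 289 * (C * (C + 2)).
  have -> : 50 / 289 * (C * (C + 2)) = (289 / 200 / (C * (C + 2) / 4))^-1.
    by field; rewrite !gt_eqF //; lra.
  by rewrite lef_pV2 ?posrE.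
have sE : (1 - p) / p = p^-1 - 1 by field; rewrite gt_eqF.
have s2 : sigma p ^+ 2 = p^-1 - 1 by rewrite /sigma sE sqr_sqrtr //; nra.
have s0 : 0 <= sigma p by rewrite sqrtr_ge0.
exists (sigma p / C); split.
- by rewrite divfK // gt_eqF.
- rewrite ler_pdivlMr // -(@ler_pXn2r _ 2) ?nnegrE //; last by lra.
  rewrite s2; nra.
- rewrite ler_pdivrMr // leNgt; apply/negP => slt.
  have g0 : 0 <= 416 / 1000 * C by clear -C0; lra.
  have : (416 / 1000 * C) * (416 / 1000 * C) < sigma p * sigma p by exact: ltr_pM.
  rewrite -[sigma p * _]expr2 s2; clear -C200 pV' C0; nra.
Qed.

End GaussLegendreParameters.

(* Evaluating these unary numerals by conversion overflows the stack. *)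
Lemma code_ratioE (R : realType) :
  206021%:R / 1000000%:R * 100%:R = 206 / 10 + 2 / 1000 + 1 / (10 * 1000) :> R.
Proof.
have -> : 206021%N = (206 * 1000 + 21)%N.
  rewrite /Nat.of_num_uint /Nat.of_uint; cbn [Nat.of_uint_acc].
  by rewrite !PeanoNat.Nat.tail_mul_spec; lia.
have -> : 1000000%N = (1000 * 1000)%N.
  rewrite /Nat.of_num_uint /Nat.of_uint; cbn [Nat.of_uint_acc].
  by rewrite !PeanoNat.Nat.tail_mul_spec; lia.
by rewrite natrD !natrM; lra.
Qed.

Theorem theorem6 (R : realType) (eps1 eps2 : nat -> R) :
  (forall c : nat, 0 < eps1 c < 1) ->
  (forall c : nat, 0 < eps2 c < 1) ->
  (exists B : R, exists c1 : nat, forall c : nat, (c1 <= c)%N ->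
      `| ln (eps2 c)^-1 / ln (eps1 c)^-1 | <= B) ->
  exists c0 : nat, forall c : nat, ~~ odd c -> (2 <= c)%N -> (c0 <= c)%N ->
    let eta1 : R := 1 / 2%:R in
    let eta2 : R := Num.sqrt c%:R / 2%:R in
    let calR := calRmin R c in
    let psi1 : R := sigma (GLp0 R c) in
    let psi2 : R := sigma (GLp0 R c) in
    let xdef (eta x : R) := 0 < x /\ x * rfun x = eta * calR * psi1 / c%:R in
    let A (x eps : R) :=
      c%:R / ((1 - eta1 - eta2 / c%:R) * calR) * (psi2 / x) * ln eps^-1 in
    (exists x1 x2 : R, xdef eta1 x1 /\ xdef eta2 x2) /\
    (forall x1 x2 : R, xdef eta1 x1 -> xdef eta2 x2 ->
       A x1 (eps1 c) + A x2 (eps2 c)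
         < (206021%:R / 1000000%:R) * 100%:R * c%:R ^+ 2 * ln (eps1 c)^-1).
Proof.
rewrite code_ratioE => e1 e2 [B [c1 HB]].
have B0 : 0 <= B by apply: le_trans (HB c1 (leqnn _)).
(* Once x_2 > T, A_2 is at most 10^-4 c^2 log (1/eps1). The condition sqrt c > M ensures x_2 > T and
   eta_2 / c <= 10^-6. *)
have [T TE] : exists T : R, T = 30 * 1000 * B + 1 by eexists.
have [M [M1 M2]] : exists M : R, 500 * 1000 <= M /\ 26 * expR T <= M.
  by have := expR_gt0 T; exists (500 * 1000 + 26 * expR T); split; lra.
exists (maxn (maxn c1 (100 * 200)) (Num.bound (M ^+ 2))) => c c_even _.
rewrite !geq_max => /andP[/andP[cc1 c_ge] cM].
have M0 : 0 < M by clear -M1; lra.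
have cR : M ^+ 2 < c%:R.
  apply: lt_le_trans (archi_boundP _) _; first by rewrite exprn_ge0 // ltW.
  by rewrite ler_nat.
have [[Z [Z0 Zle ->]] _] := GL_parameters R c_even c_ge.
have [y [-> y4 yle]] := sigma_GLp0_bounds R c_even c_ge.
have l1 : 0 < ln (eps1 c)^-1.
  by have /andP[? ?] := e1 c; rewrite ln_gt0 // invf_gt1.
have l2 : ln (eps2 c)^-1 <= B * ln (eps1 c)^-1.
  by rewrite -ler_pdivrMr // (le_trans (ler_norm _)) // HB.
clear HB cM c_even c_ge cc1 e1 e2.
set q := Num.sqrt c%:R; have qM : M < q.
  by rewrite -[M]ger0_norm ?ltW // -sqrtr_sqr ltr_sqrt // (le_lt_trans _ cR) // sqr_ge0.
have qq : q ^+ 2 = c%:R by rewrite sqr_sqrtr // ler0n.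
rewrite -qq; move: {qq cR} q qM => q qM.
have q0 : 0 < q by apply: lt_trans qM.
have qbig : 500 * 1000 < q.
  exact: le_lt_trans qM.
have y0 : 0 < y by clear -y4; lra.
pose d := 1 / (2 * q).
have qn0 : q != 0 by rewrite gt_eqF.
have dE : q / 2%:R / q ^+ 2 = d by rewrite /d; field.
have d0 : 0 <= d by rewrite divr_ge0 // mulr_ge0 // ltW.
have dle : d <= 1 / (1000 * 1000).
  by rewrite /d ler_pdivrMr ?mulr_gt0 //; clear -qbig; lra.
have Zn0 : Z != 0 by rewrite gt_eqF.
move=> eta1 eta2 calR psi1 psi2 xdef A.
have rhs eta : eta * calR * psi1 / q ^+ 2 = eta * Z^-1 * y.
  by rewrite /calR /psi1; field; rewrite Zn0.
have h0 : 0 < 1 / 2 - d by clear -dle; lra.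
(* Since sigma (p_0) = y c and c = q^2, the factor c^2 comes out of each A_i. *)
have AE x e : 0 < x -> A x e = q ^+ 2 ^+ 2 * (y * Z / ((1 / 2 - d) * x)) * ln e^-1.
  move=> x0; rewrite /A /eta1 /eta2 /calR /psi2 dE.
  have -> : 1 - 1 / 2%:R - d = 1 / 2 - d by clear; lra.
  have hn0 : 1 / 2 - d != 0 by rewrite gt_eqF.
  move: (1 / 2 - d) hn0 => h hn0.
  by field; rewrite hn0 Zn0 gt_eqF.
have ZV : Z^-1 * y > 0 by rewrite mulr_gt0 ?invr_gt0.
have e20 : 0 < eta2 by rewrite divr_gt0.
split.
  have [|x1 [x10 Hx1]] := @rfun_surj R (eta1 * Z^-1 * y).
    by rewrite -mulrA mulr_gt0 // divr_gt0.
  have [|x2 [x20 Hx2]] := @rfun_surj R (eta2 * Z^-1 * y).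
    by rewrite -mulrA mulr_gt0.
  by exists x1, x2; rewrite /xdef !rhs.
move=> x1 x2; rewrite /xdef !rhs => -[x10 Hx1] [x20 Hx2]; rewrite !AE //.
have A1 := code_length_const Z0 Zle y0 yle d0 dle x10 Hx1.
(* e^(x_2) >= x_2 r(x_2) = eta_2 y / Z >= (q / 2) (10 / 128) > e^T, by 1/Z >= 10/32, y >= 1/4 and q
   > 26 e^T. *)
have x2T : T < x2.
  rewrite -ltr_expR; apply: lt_le_trans (le_expR_rfun x20).
  have ZV' : 10 / 32 <= Z^-1.
    have -> : 10 / 32 = (32 / 10)^-1 :> R by field.
    have g0 : 0 < 32 / 10 :> R by rewrite divr_gt0 ?ltr0n.
    by rewrite lef_pV2 ?posrE //; clear -Zle; lra.
  have Zy : 10 / 32 * (1 / 4) <= Z^-1 * y.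
    by apply: ler_pM => //; rewrite ?divr_ge0 ?ler0n.
  have : eta2 * (10 / 32 * (1 / 4)) <= eta2 * (Z^-1 * y).
    by rewrite (ler_pM2l e20).
  rewrite Hx2 -[_ * Z^-1 * y]mulrA => H.
  apply: lt_le_trans H; rewrite /eta2; have E0 := expR_gt0 T.
  by clear -qM M2 E0; lra.
have T0 : 0 < T by clear -TE B0; lra.
have A2 : y * Z / ((1 / 2 - d) * x2) * B <= 1 / (10 * 1000).
  have Zy : y * Z <= 14 / 10.
    apply: (@le_trans _ _ (416 / 1000 * (2152 / 685))).
      by apply: ler_pM => //; exact: ltW.
    by clear -B; lra.
  have hx : 0 < (1 / 2 - d) * x2 by rewrite mulr_gt0.
  rewrite mulrAC ler_pdivrMr //.
  apply: (@le_trans _ _ (14 / 10 * B)); first by rewrite ler_wpM2r.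
  have hT : (1 / 2 - 1 / (1000 * 1000)) * T <= (1 / 2 - d) * x2.
    apply: ler_pM; [by clear -B; lra | exact: ltW | by clear -dle; lra | exact: ltW].
  by clear -hT TE B0; rewrite TE in hT; lra.
have Q0 : 0 < q ^+ 2 ^+ 2 by rewrite !exprn_gt0.
have a20 : 0 <= y * Z / ((1 / 2 - d) * x2).
  by rewrite divr_ge0 // mulr_ge0 // ltW.
move: (q ^+ 2 ^+ 2) Q0 => Q Q0.
move: (y * Z / ((1 / 2 - d) * x1)) A1 => a1 A1.
move: (y * Z / ((1 / 2 - d) * x2)) A2 a20 => a2 A2 a20.
rewrite [_ * Q]mulrC -!(mulrA Q) -mulrDr ltr_pM2l //.
(* The budget 20.6021 splits as 20.602 for A_1 and 0.0001 for A_2. *)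
apply: (@lt_le_trans _ _ ((206 / 10 + 2 / 1000) * ln (eps1 c)^-1 + a2 * ln (eps2 c)^-1)).
  by rewrite ltrD2r ltr_pM2r.
rewrite [leRHS]mulrDl lerD2l; apply: (@le_trans _ _ (a2 * (B * ln (eps1 c)^-1))).
  exact: ler_wpM2l.
by rewrite mulrA ler_pM2r.
Qed.
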